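(* Let $p\ge2$, let $T=(T^{(N)})_{N\ge1}$ be a sequence of heavy-Wigner tensors of order $p$ with parameters $(M_k)_{k\ge2}$, and let $\nu$ be the limit (weakly in probability, as $N\to\infty$) of the empirical spectral distributions of the matrices $$(\tilde A_N)_{a,b}=\frac{1}{\sqrt{M_2(p-2)!}}\sum_{j_1,\dots,j_{p-2}=1}^N T^{(N)}_{a,b,j_1,\dots,j_{p-2}},\qquad 1\le a,b\le N,$$ i.e. the probability measure with moments $(\eta_k^{(M'_r)})_{k\ge0}$, $M'_r=(p-2)!^{r/2}M_r/M_2^{r/2}$ (with $M_2>0$). If $M_{2r}>0$ for some $r>1$, then $\nu$ is not compactly supported.
   Context: Heavy-Wigner tensors: a sequence of heavy-Wigner tensors of order $p$ with parameters $(M_k)_{k\ge2}$ is a sequence $(T^{(N)})_{N\ge1}$ of real random tensors $T^{(N)}=(T_{i_1,\dots,i_p})_{1\le i_1,\dots,i_p\le N}$ that are symmetric (invariant under permutation of the indices), whose entries indexed by $i_1\le\cdots\le i_p$ are independent (not necessarily identically distributed), such that $\mathbb{E}[T_{i_1,\dots,i_p}]=0$ for all indices, for every $k\ge2$ one has $\sup_{i_1,\dots,i_p}N^{p-1}\mathbb{E}[T_{i_1,\dots,i_p}^k]=O(1)$ as $N\to\infty$, and for all $i_1<\cdots<i_p$ and every $k\ge2$, $N^{p-1}\mathbb{E}[T_{i_1,\dots,i_p}^k]\to M_k$ as $N\to\infty$. Definition of $\eta_k$: a hypertree is a simple hypergraph (distinct hyperedges, each a set of distinct vertices) whose vertex–hyperedge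 incidence bipartite graph is a tree. A rooted $p$-uniform fat hypertree $(H,o)$ is a $p$-uniform hypertree with a distinguished vertex $o$ together with a multiplicity for each hyperedge. For a sequence of real numbers $(a_r)_{r\ge2}$, put $\eta_0^{(a_r)}=1$ and, for $k\ge1$, $$\eta_k^{(a_r)}=\sum_{(H,o)\in\mathcal{T}_k^\bullet}\frac{1}{|\mathrm{Aut}(H,o)|}\sum_{P\in P_k(H)}\ \prod_{e\in E(H)}a_{m(P,e)},$$ where $\mathcal{T}_k^\bullet$ is the set of isomorphism classes of rooted $p$-uniform fat hypertrees with $k$ hyperedges counted with multiplicity, every hyperedge having multiplicity at least $2$; $\mathrm{Aut}(H,o)$ is the group of automorphisms of $H$ (permutations of the vertices preserving hyperedges and their multiplicities) fixing the root; $P_k(H)$ is the set of closed walks of length $k$ starting from the root $o$ on the clique expansion of $H$ (the graph where two distinct vertices are adjacent iff they lie in a common hyperedge) such that, for each distinct hyperedge $e$, the number $m(P,e)$ of steps of the walk $P$ using an edge coming from $e$ equals the multiplicity of $e$ in $H$; and the product runs over the distinct hyperedges of $H$. The empirical spectral distribution of a real symmetric $N\times N$ matrix is the uniform probability measure on its eigenvalues.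
   Formalization: The convergence of N^{p-1}E[T_{i_1..i_p}^k] to M_k is taken uniformly over i_1<...<i_p in [N]; for fixed indices only, entries with large indices could have other moments, and the limit would not be the measure with moments eta_k. *)

(* Defs.v *)
From HB Require Import structures.
From mathcomp Require Import all_boot all_order perm all_algebra.
From mathcomp Require Import all_classical all_reals all_analysis.
Import Order.TTheory GRing.Theory Num.Theory numFieldNormedType.Exports.

Set Implicit Arguments.
Unset Strict Implicit.
Unset Printing Implicit Defensive.

Local Open Scope classical_set_scope.
Local Open Scope ring_scope.

(** * Hypertrees and the numbers [eta] *)

Definition is_tree (V : finType) (adj : rel V) : Prop :=
  (forall u v, connect adj u v) /\
  (forall c : seq V, (2 < size c)%N -> ~~ ucycleb adj c).

(** A rooted fat hypergraph on the vertex set ['I_n] is a pair [(m, o)] where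
    [o] is the root and [m e] is the multiplicity of [e], equal to [0] when [e]
    is not a hyperedge. The total multiplicity being [k], every multiplicity is
    at most [k]; bounding it in the type makes the type finite. *)
Definition fat_hypergraph (n k : nat) : finType :=
  ({ffun {set 'I_n} -> 'I_k.+1} * 'I_n)%type.

Section FatHypergraph.
Context (n k : nat).
Implicit Types (H : fat_hypergraph n k) (w : k.-tuple 'I_n).

Definition multiplicity H (e : {set 'I_n}) : nat := H.1 e.

Definition root_vertex H : 'I_n := H.2.

Definition hyperedges H : {set {set 'I_n}} :=
  [set e | multiplicity H e != 0%N]%SET.

Definition incidence H : rel ('I_n + {e | e \in hyperedges H}) :=
  fun u v => match u, v with
             | inl x, inr e | inr e, inl x => x \in val e
             | _, _ => false
             end.

Definition is_fat_hypertree (p : nat) H : Prop :=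
  [/\ (forall e, e \in hyperedges H -> #|e| = p),
      is_tree (@incidence H),
      (forall e, e \in hyperedges H -> (2 <= multiplicity H e)%N) &
      (\sum_(e in hyperedges H) multiplicity H e)%N = k].

Definition isomorphism H H' (s : 'S_n) : bool :=
  (s (root_vertex H) == root_vertex H') &&
  [forall e : {set 'I_n}, multiplicity H' (s @: e)%SET == multiplicity H e].

Definition isomorphic : rel (fat_hypergraph n k) :=
  fun H H' => [exists s : 'S_n, isomorphism H H' s].

Definition Aut H : {set 'S_n} := [set s | isomorphism H H s]%SET.

Definition clique_adj H : rel 'I_n :=
  fun x y => (x != y) && [exists e in hyperedges H, (x \in e) && (y \in e)].

(** The tuple [w] lists the positions of the walk after each of its [k] steps.
    In a hypertree two distinct vertices lie in at most one common hyperedge,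
    hence a step comes from [e] if and only if both its ends lie in [e]. *)
Definition steps_in H w (e : {set 'I_n}) : nat :=
  count (fun xy => (xy.1 \in e) && (xy.2 \in e)) (zip (root_vertex H :: w) w).

Definition closed_walks H : {set k.-tuple 'I_n} :=
  [set w : k.-tuple 'I_n |
    [&& path (clique_adj H) (root_vertex H) w,
        last (root_vertex H) w == root_vertex H &
        [forall e in hyperedges H, steps_in H w e == multiplicity H e]]]%SET.

Definition fat_hypertrees (p : nat) : {set fat_hypergraph n k} :=
  [set H | `[< is_fat_hypertree p H >]]%SET.

Definition iso_representatives (p : nat) : {set fat_hypergraph n k} :=
  transversal (equivalence_partition isomorphic (fat_hypertrees p))
              (fat_hypertrees p).

Definition weight (R : realType) (a : nat -> R) H : R :=
  (#|Aut H|%:R)^-1 *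
  \sum_(w in closed_walks H) \prod_(e in hyperedges H) a (steps_in H w e).

End FatHypergraph.

(** Isomorphic hypertrees have the same number [n] of vertices, and a
    [p]-uniform hypertree with [h] hyperedges has [1 + h * (p - 1)] vertices,
    where [h <= k] here: the range of [n] covers all isomorphism classes. *)
Definition eta (R : realType) (p : nat) (a : nat -> R) (k : nat) : R :=
  if k == 0%N then 1
  else \sum_(n < (1 + k * p).+1)
         \sum_(H in @iso_representatives n k p) weight a H.

(** * Heavy-Wigner tensors *)

Definition mutually_independent (R : realType) (d : measure_display)
    (Omega : measurableType d) (P : probability Omega R) (I : finType)
    (A : pred I) (X : I -> {RV P >-> R}) : Prop :=
  forall J : {set I}, {subset J <= A} ->
  forall B : I -> set R, (forall i, measurable (B i)) ->
  P (\bigcap_(i in [set` J]) (X i @^-1` B i)) =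
  (\prod_(i in J) P (X i @^-1` B i))%E.

Definition nondecreasing_index (N p : nat) (i : p.-tuple 'I_N) : bool :=
  sorted leq (map val i).

Definition increasing_index (N p : nat) (i : p.-tuple 'I_N) : bool :=
  sorted ltn (map val i).

Section HeavyWigner.
Context (R : realType) (p : nat) (d : nat -> measure_display).
Context (Omega : forall N, measurableType (d N)).
Context (P : forall N, probability (Omega N) R).
Context (T : forall N, p.-tuple 'I_N -> {RV (P N) >-> R}).

Definition scaled_moment (N : nat) (i : p.-tuple 'I_N) (k : nat) : R :=
  (N ^ p.-1)%:R * \int[P N]_w (T i w ^+ k).

(** The convergence of the moments is uniform in [i_1 < ... < i_p]: these are
    indices of [T^(N)], which may vary with [N]. With convergence only for fixed
    indices, the limit spectrum would not be determined by [M]. *)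
Record heavy_wigner (M : nat -> R) : Prop := HeavyWigner {
  hw_symmetric : forall N (i j : p.-tuple 'I_N), perm_eq i j -> T i =1 T j ;
  hw_independent : forall N,
    mutually_independent (@nondecreasing_index N p) (@T N) ;
  hw_finite_moments : forall N (i : p.-tuple 'I_N) k,
    (P N).-integrable [set: Omega N] (fun w => (T i w ^+ k)%:E) ;
  hw_centered : forall N (i : p.-tuple 'I_N), ('E_(P N)[T i] = 0)%E ;
  hw_bounded : forall k, (2 <= k)%N ->
    (fun N => sup (range (fun i : p.-tuple 'I_N => scaled_moment i k)))
      =O_\oo (fun=> 1 : R) ;
  hw_limit : forall k, (2 <= k)%N -> forall eps : R, 0 < eps ->
    \forall N \near \oo, forall i : p.-tuple 'I_N, increasing_index i ->
      `|scaled_moment i k - M k| < eps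
}.

(** The tuples [i] of the sum are the [(a, b, j_1, ..., j_(p-2))]. *)
Definition contracted_mx (M : nat -> R) (N : nat) (w : Omega N) : 'M[R]_N :=
  \matrix_(a, b) ((Num.sqrt (M 2%N * (p - 2)`!%:R))^-1 *
                  \sum_(i : p.-tuple 'I_N | take 2 i == [:: a; b]) T i w).

End HeavyWigner.

(** * Spectral distributions *)

(** The eigenvalues of a matrix with split characteristic polynomial (such as
    a real symmetric matrix), with multiplicity, in nonincreasing order. *)
Definition eigenvalues (R : realType) (n : nat) (A : 'M[R]_n) : n.-tuple R :=
  xget [tuple 0 | _ < n]
    [set s : n.-tuple R | sorted >=%R s /\
                          char_poly A = \prod_(x <- s) ('X - x%:P)].

Definition esd (R : realType) (n : nat) (A : 'M[R]_n) :
    {measure set (measurableTypeR R) -> \bar R} :=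
  mscale (n%:R^-1)%:nng
    (msum (fun i : nat => \d_((eigenvalues A)`_i : measurableTypeR R)) n).

Definition cvg_weakly_in_probability (R : realType) (d : nat -> measure_display)
    (Omega : forall N, measurableType (d N))
    (P : forall N, probability (Omega N) R)
    (mu : forall N, Omega N -> {measure set (measurableTypeR R) -> \bar R})
    (nu : probability (measurableTypeR R) R) : Prop :=
  forall f : R -> R, continuous f -> (exists C : R, forall x, `|f x| <= C) ->
  forall eps : R, 0 < eps ->
  P N [set w | eps < `|\int[mu N w]_x f x - \int[nu]_x f x|]
    @[N --> \oo] --> 0%E.

Definition has_moments (R : realType) (nu : probability (measurableTypeR R) R)
    (m : nat -> R) : Prop :=
  forall k : nat,
    nu.-integrable [set: R] (fun x => (x ^+ k)%:E) /\
    \int[nu]_x (x ^+ k) = m k.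

Definition compactly_supported (R : realType)
    (nu : probability (measurableTypeR R) R) : Prop :=
  exists K : set R, compact K /\ nu (~` K) = 0%E.

(* Main.v *)
(** Suppose that [nu] is supported in [-C, C] and put [c = C^2]. Then
    [f(x) = min(x^2, c)] satisfies [int f dnu = int x^2 dnu = eta_2 >= 1]. On the
    other hand, let [A] be the random matrix and [S_a = (A^2)_(a,a)]. Jensen's
    inequality, applied to the spectral measures of the coordinate vectors, gives
    [sum_i f(lambda_i) <= sum_a min(S_a, c)], and [E S_a] is asymptotically at
    most [1]. It therefore suffices that [E (S_a - c)_+] stays away from [0].

    This is seen by a change of measure that makes large entries more likely
    but keeps the entries independent. For the density
    [Y = prod_k (1 + theta T_k^(2r-2))], over the entries [T_k] that touch [a],
    the ratio [E(S_a Y) / E Y] is at least a constant times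
    [theta M_(2r) / M_2], hence exceeds [c + 1] for [theta] large, while [E Y]
    and [E(S_a Y^2)] remain bounded. Integrating
    [(S - c)_+ >= 2 t Y (S - c) - t^2 Y^2 S] with a small [t > 0] concludes.
    Only moments of single entries occur, so the possibly negative odd
    parameters [M_k] cause no cancellation. *)
From HB Require Import structures.
Require Import Defs.
From mathcomp Require Import all_boot all_order perm all_algebra.
From mathcomp Require Import all_classical all_reals all_analysis.
From mathcomp Require Import sesquilinear spectral.
From mathcomp Require Import complex.
From mathcomp Require Import measurable_realfun ring lra zify.
Import Order.TTheory GRing.Theory Num.Theory numFieldNormedType.Exports.
Set Implicit Arguments.
Unset Strict Implicit.
Unset Printing Implicit Defensive.
Local Open Scope classical_set_scope.
Local Open Scope ring_scope.

(** * Expectations of products of independent variables *)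

(** The tilt is confined to one row for a reason of size. About N^(p-1) entries touch [a], each with
    even moments O(N^(1-p)), so the mass of the density is a product bounded by exp(O(1)). Over all
    entries the same bound would only be exp(O(N)), and the gain would not be uniform in N. The
    price of the tilt is that entries lose their centering. Their new means are O(N^(1-p)), the same
    order as their new second moments. The squared means are therefore negligible in each variance,
    which serves the lower bound. For the upper bound, N^(p-2) means add up coherently to O(1/N);
    squared and summed over the N values of [b], they contribute O(1/N). Two defects of the data are
    repaired throughout. Independence holds only for nondecreasing indices, so every index passes
    through its sorted rearrangement. The limits M_k are known only for distinct indices; the other
    indices are a fraction O(1/N) of a row, and the uniform moment bound suffices for them. *)

Section Factorization.
Context (R : realType) (d : measure_display) (Omega : measurableType d).
Context (P : probability Omega R).
Import HBNNSimple.

(** In the application [W] is the product of the remaining factors, whose independence of [X] is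
    known only on events: [WB] records it, and [c] is the integral of [W]. Simple functions and
    monotone convergence extend it to [f]. *)
Lemma ge0_integral_factor (X : {RV P >-> R}) (W : Omega -> R) (c : R)
    (f : R -> R) :
  measurable_fun setT W -> (forall x, 0 <= W x) -> 0 <= c ->
  (forall B, measurable B ->
     \int[P]_x (W x * \1_B (X x))%:E = c%:E * P (X @^-1` B))%E ->
  measurable_fun setT f -> (forall x, 0 <= f x) ->
  (\int[P]_x (W x * f (X x))%:E = c%:E * \int[P]_x (f (X x))%:E)%E.
Proof.
move=> mW W0 c0 WB mf f0.
have mEf : measurable_fun [set: measurableTypeR R] (fun y => (f y)%:E).
  exact/measurable_EFinP.
have f0' y : [set: measurableTypeR R] y -> (0 <= (fun y => (f y)%:E) y)%E.
  by move=> _; rewrite lee_fin.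
pose h := nnsfun_approx measurableT mEf.
have mhX n : measurable_fun setT (fun x => h n (X x)).
  have mhn : measurable_fun setT (h n) by exact: measurable_funPT.
  exact: (measurableT_comp mhn (measurable_funPT X)).
have hcvg x : (h n (X x))%:E @[n --> \oo] --> (f (X x))%:E.
  exact: (cvg_nnsfun_approx measurableT mEf f0' (x := X x)).
have hnd x n m : (n <= m)%N -> h n (X x) <= h m (X x).
  by move=> nm; have /lefP/(_ (X x)) := nd_nnsfun_approx measurableT mEf nm.
have -> : (\int[P]_x (f (X x))%:E = lim (\int[P]_x (h n (X x))%:E @[n --> \oo]))%E.
  under eq_integral => x _ do rewrite -(cvg_lim _ (hcvg x))//.
  apply: monotone_convergence => //.
  - by move=> n; apply/measurable_EFinP.
  - by move=> n x _; rewrite lee_fin.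
  - by move=> x _ n m nm; rewrite lee_fin hnd.
have Wcvg x : (W x * h n (X x))%:E @[n --> \oo] --> (W x * f (X x))%:E.
  by rewrite EFinM; under eq_fun do rewrite EFinM; exact: cvgeZl.
have -> : (\int[P]_x (W x * f (X x))%:E =
           lim (\int[P]_x (W x * h n (X x))%:E @[n --> \oo]))%E.
  under eq_integral => x _ do rewrite -(cvg_lim _ (Wcvg x))//.
  apply: monotone_convergence => //.
  - by move=> n; apply/measurable_EFinP/measurable_funM.
  - by move=> n x _; rewrite lee_fin mulr_ge0.
  - by move=> x _ n m nm; rewrite lee_fin ler_wpM2l ?hnd.
have hint n : (\int[P]_x (W x * h n (X x))%:E = c%:E * \int[P]_x (h n (X x))%:E)%E.
  have hE t : h n t = \sum_(y \in range (h n)) (y * \1_(h n @^-1` [set y]) t).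
    exact: fimfunE.
  have y0 y t : 0 <= y * \1_(h n @^-1` [set y]) t.
    rewrite indicE; have [|_] := boolP (t \in _); last by rewrite mulr0.
    by rewrite inE /= mulr1 => <-.
  have mB y : measurable (h n @^-1` [set y]) by exact: measurable_sfunP.
  have mI y : measurable_fun setT (fun x => \1_(h n @^-1` [set y]) (X x) : R).
    have mi := @measurable_indic _ _ R setT _ (mB y).
    exact: (measurableT_comp mi (measurable_funPT X)).
  have mIy y : measurable_fun setT
      (fun x => (y * \1_(h n @^-1` [set y]) (X x))%:E).
    by apply/measurable_EFinP/measurable_funM.
  under eq_integral => x _.
    rewrite {1}hE EFinM -fsumEFin// ge0_mule_fsumr; last first.
      by move=> y; rewrite lee_fin.
    over.
  rewrite ge0_integral_fsum//; last 2 first.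
    by move=> y; apply: emeasurable_funM => //; exact/measurable_EFinP.
    by move=> y x _; rewrite mule_ge0 ?lee_fin.
  under [in RHS]eq_integral => x _ do rewrite hE -fsumEFin//.
  rewrite ge0_integral_fsum//; last by move=> y x _; rewrite lee_fin.
  rewrite ge0_mule_fsumr; last first.
    by move=> y; apply: integral_ge0 => x _; rewrite lee_fin.
  apply: eq_fsbigr => y; rewrite inE => -[z _ <-{y}]; set y := h n z.
  have y_ge0 : 0 <= y by [].
  under eq_integral => x _ do rewrite -EFinM mulrCA EFinM.
  rewrite ge0_integralZl//; last 2 first.
    by apply/measurable_EFinP/measurable_funM.
    by move=> x _; rewrite lee_fin mulr_ge0.
  rewrite WB; last exact: mB.
  have -> : (\int[P]_x (y * \1_(h n @^-1` [set y]) (X x))%:E =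
             y%:E * \int[P]_x (\1_(X @^-1` (h n @^-1` [set y])) x)%:E)%E.
    under eq_integral => x _ do rewrite EFinM.
    by rewrite ge0_integralZl//; exact/measurable_EFinP.
  rewrite integral_indic; last 2 first.
  - exact: measurableT.
  - by rewrite -[X in measurable X]setTI; apply: measurable_funPT => //; exact: mB.
  by rewrite setIT muleCA.
under eq_fun do rewrite hint.
rewrite limeMl//; apply: ereal_nondecreasing_is_cvgn => n m nm.
apply: ge0_le_integral => //.
- by move=> x _; rewrite lee_fin.
- exact/measurable_EFinP.
- exact/measurable_EFinP.
- by move=> x _; rewrite lee_fin hnd.
Qed.
End Factorization.

Section IndependentProducts.
Context (R : realType) (d : measure_display) (Omega : measurableType d).
Context (P : probability Omega R).
Context (I : finType) (A : pred I) (X : I -> {RV P >-> R}).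
Hypothesis indep : mutually_independent A X.
Implicit Types g : I -> R -> R.

Lemma measurable_prod_RV g (Q : pred I) : (forall i, measurable_fun setT (g i)) ->
  measurable_fun setT (fun w => \prod_(i | Q i) g i (X i w)).
Proof.
move=> mg; under eq_fun do rewrite -big_filter.
apply: measurable_prod => i _.
exact: (measurableT_comp (mg i) (measurable_funPT (X i))).
Qed.

(* Induction on the set of indices [i] such that [g i] is not an indicator. *)
Lemma ge0_expectation_prod g (J : {set I}) : {subset J <= A} ->
  (forall i, measurable_fun setT (g i)) -> (forall i x, 0 <= g i x) ->
  (forall i, i \in J -> P.-integrable setT (fun w => (g i (X i w))%:E)) ->
  (\int[P]_w (\prod_(i in J) g i (X i w))%:E =
   \prod_(i in J) \int[P]_w (g i (X i w))%:E)%E.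
Proof.
move=> JA mg g0 ig.
have : forall i, i \notin enum I -> exists2 B, measurable B & g i = \1_B.
  by move=> i; rewrite mem_enum.
elim: (enum I) => [|j s IH] in g mg g0 ig *.
  move=> gB; pose B i := xget setT [set B | measurable B /\ g i = \1_B].
  have gBE i : measurable (B i) /\ g i = \1_(B i).
    have [|B0 mB0 gB0] := gB i; first by rewrite in_nil.
    by have : [set B | measurable B /\ g i = \1_B] (B i) by apply: xgetPex; exists B0.
  have mXB i : measurable (X i @^-1` B i).
    by rewrite -[X in measurable X]setTI; apply: measurable_funPT => //; exact: (gBE i).1.
  have giE i : (fun w => (g i (X i w))%:E) = EFin \o \1_(X i @^-1` B i).
    by rewrite (gBE i).2.
  under [RHS]eq_bigr => i _ do rewrite giE integral_indic// setIT.
  rewrite -(indep JA (fun i => (gBE i).1)).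
  have mcap : measurable (\bigcap_(i in [set` J]) (X i @^-1` B i)).
    by apply: fin_bigcap_measurable.
  transitivity (\int[P]_w (\1_(\bigcap_(i in [set` J]) (X i @^-1` B i)) w)%:E)%E.
    apply: eq_integral => w _; congr EFin.
    rewrite indicE; have [|] := boolP (w \in _); rewrite ?inE ?notin_setE /= => wB.
      by rewrite big1// => i iJ; rewrite (gBE i).2 indicE mem_set//; exact: wB.
    move/existsNP: wB => [i /not_implyP[iJ nB]].
    by rewrite (bigD1 i)//= (gBE i).2 indicE memNset// mul0r.
  by rewrite integral_indic ?setIT.
move=> gB.
have [jJ|jJ] := boolP (j \in J); last first.
  pose g' i := if i == j then \1_setT else g i.
  have E w : \prod_(i in J) g i (X i w) = \prod_(i in J) g' i (X i w).
    apply: eq_bigr => i iJ; rewrite /g'; case: eqVneq => // ij.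
    by rewrite ij (negbTE jJ) in iJ.
  have g'E i : i \in J -> g' i = g i.
    by move=> iJ; rewrite /g'; case: eqVneq => // ij; rewrite ij (negbTE jJ) in iJ.
  under eq_integral => w _ do rewrite E.
  rewrite IH; first by apply: eq_bigr => i iJ; rewrite g'E.
  - by move=> i; rewrite /g'; case: eqP => // _; exact: measurable_indic.
  - by move=> i x; rewrite /g'; case: eqP => // _; rewrite indicE.
  - by move=> i iJ; rewrite g'E// ig.
  - move=> i nis; rewrite /g'; case: eqVneq => [_|ij]; first by exists setT.
    by apply: gB; rewrite inE negb_or ij.
pose g' B i := if i == j then \1_B else g i.
have pE B i : (i \in J) && (i != j) -> g' B i = g i.
  by move=> /andP[_ /negPf ij]; rewrite /g' ij.
pose W w := \prod_(i in J | i != j) g i (X i w).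
have fint i : i \in J -> (\int[P]_w (g i (X i w))%:E \is a fin_num)%E.
  by move=> iJ; exact: integrable_fin_num (ig _ iJ).
pose c := fine (\prod_(i in J | i != j) \int[P]_w (g i (X i w))%:E)%E.
have cE : (c%:E = \prod_(i in J | i != j) \int[P]_w (g i (X i w))%:E)%E.
  by rewrite fineK// prode_fin_num// => i /andP[iJ _]; exact: fint.
under eq_integral => w _ do rewrite (bigD1 j)//= mulrC -/(W w).
rewrite (ge0_integral_factor (X:=X j) (W:=W) (c:=c))//.
- by rewrite (bigD1 j)//= cE muleC.
- exact: measurable_prod_RV.
- by move=> w; apply: prodr_ge0.
- by rewrite fine_ge0// prode_ge0// => i _; apply: integral_ge0 => w _; rewrite lee_fin.
(* Once the factor at [j] is replaced by the indicator of [B], the index [j] leaves the list of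
   exceptions and the induction hypothesis evaluates the integral. *)
move=> B mB.
transitivity (\int[P]_w (\prod_(i in J) g' B i (X i w))%:E)%E.
  apply: eq_integral => w _; rewrite (bigD1 j)//= mulrC /g' eqxx; congr (_ * _)%:E.
  by apply: eq_bigr => i iJ; rewrite -/(g' B i) pE.
have mXB : measurable (X j @^-1` B).
  by rewrite -[X in measurable X]setTI; exact: measurable_funPT.
have XBE : (fun w => (g' B j (X j w))%:E) = EFin \o \1_(X j @^-1` B).
  by rewrite /g' eqxx.
rewrite IH.
- rewrite (bigD1 j)//= XBE integral_indic// setIT muleC cE; congr (_ * _)%E.
  by apply: eq_bigr => i iJ; rewrite pE.
- by move=> i; rewrite /g'; case: eqP => // _; exact: measurable_indic.
- by move=> i x; rewrite /g'; case: eqP => // _; rewrite indicE.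
- move=> i iJ; have [->|ij] := eqVneq i j; last by rewrite pE ?iJ ?ij// ig.
  by rewrite XBE; apply: integrable_indic.
- move=> i nis; rewrite /g'; case: eqVneq => [_|ij]; first by exists B.
  by apply: gB; rewrite inE negb_or ij.
Qed.

(* Induction on the set of indices [i] such that [g i] takes negative values. *)
Lemma expectation_prod g (J : {set I}) : {subset J <= A} ->
  (forall i, measurable_fun setT (g i)) ->
  (forall i, i \in J -> P.-integrable setT (fun w => (g i (X i w))%:E)) ->
  P.-integrable setT (fun w => (\prod_(i in J) g i (X i w))%:E) /\
  \int[P]_w (\prod_(i in J) g i (X i w)) = \prod_(i in J) \int[P]_w g i (X i w).
Proof.
move=> JA mg ig.
have : forall i, i \notin enum I -> forall x, 0 <= g i x.
  by move=> i; rewrite mem_enum.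
elim: (enum I) => [|j s IH] in g mg ig *.
  move=> g0; have {}g0 i x : 0 <= g i x by exact: g0.
  have fint i : i \in J -> (\int[P]_w (g i (X i w))%:E \is a fin_num)%E.
    by move=> iJ; exact: integrable_fin_num (ig _ iJ).
  have E := ge0_expectation_prod JA mg g0 ig.
  split.
    apply/integrableP; split; first exact/measurable_EFinP/measurable_prod_RV.
    under eq_integral => w _ do rewrite gee0_abs ?lee_fin ?prodr_ge0//.
    by rewrite E ltey_eq prode_fin_num.
  rewrite /Rintegral E; apply: EFin_inj; rewrite fineK ?prode_fin_num// -prodEFin.
  by apply: eq_bigr => i iJ; rewrite fineK ?fint.
move=> g0.
have [jJ|jJ] := boolP (j \in J); last first.
  pose g' i := if i == j then cst 1 else g i.
  have g'E i : i \in J -> g' i = g i.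
    by move=> iJ; rewrite /g'; case: eqVneq => // ij; rewrite ij (negbTE jJ) in iJ.
  have E w : \prod_(i in J) g' i (X i w) = \prod_(i in J) g i (X i w).
    by apply: eq_bigr => i iJ; rewrite g'E.
  have [||i nis x|] := IH g'.
  - by move=> i; rewrite /g'; case: eqP.
  - by move=> i iJ; rewrite g'E// ig.
  - rewrite /g'; case: eqVneq => [_|ij]; first exact: ler01.
    by apply: g0; rewrite inE negb_or ij.
  under eq_fun do rewrite E.
  move=> ? H; split=> //; transitivity (\int[P]_w (\prod_(i in J) g' i (X i w))).
    by apply: eq_Rintegral => w _; rewrite E.
  by rewrite H; apply: eq_bigr => i iJ; rewrite g'E.
(* The factor at [j] is split into its positive and negative parts. Both are dominated by its
   absolute value, hence integrable, and both are nonnegative, so the induction hypothesis applies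
   to each. *)
pose g' (u : R -> R) i := if i == j then u \o g j else g i.
pose pos (x : R) := Num.max x 0; pose neg (x : R) := Num.max (- x) 0.
have pE u i : (i \in J) && (i != j) -> g' u i = g i.
  by move=> /andP[_ /negPf ij]; rewrite /g' ij.
have IHu (u : R -> R) : measurable_fun setT u -> (forall x, 0 <= u x <= `|x|) ->
  P.-integrable setT (fun w => (\prod_(i in J) g' u i (X i w))%:E) /\
  \int[P]_w (\prod_(i in J) g' u i (X i w)) = \prod_(i in J) \int[P]_w g' u i (X i w).
  move=> mu u0; apply: IH => i.
  - by rewrite /g'; case: eqP => _ //; exact: measurableT_comp.
  - move=> iJ; have [->|ij] := eqVneq i j; last by rewrite pE ?iJ ?ij// ig.
    rewrite /g' eqxx; apply: le_integrable (ig _ jJ) => //.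
      apply/measurable_EFinP; exact: (measurableT_comp mu
        (measurableT_comp (mg j) (measurable_funPT (X j)))).
    move=> w _ /=; rewrite lee_fin ger0_norm; first exact: (andP (u0 _)).2.
    exact: (andP (u0 _)).1.
  - move=> nis x; rewrite /g'; case: eqVneq => [_|ij]; first exact: (andP (u0 _)).1.
    by apply: g0; rewrite inE negb_or ij.
have [||ip Ep] := IHu pos.
- by apply: measurable_maxr.
- by move=> x; rewrite /pos le_max lexx orbT/= ge_max ler_norm normr_ge0.
have [||iN EN] := IHu neg.
- by apply: measurable_maxr => //; exact: measurable_oppr.
- by move=> x; rewrite /neg le_max lexx orbT/= ge_max normr_ge0 -normrN ler_norm.
have posneg x : pos x - neg x = x.
  by rewrite /pos /neg; have [x0|x0] := leP 0 x; rewrite /Num.max; do 2 case: ltP; lra.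
have gE w : \prod_(i in J) g i (X i w) =
    \prod_(i in J) g' pos i (X i w) - \prod_(i in J) g' neg i (X i w).
  rewrite !(bigD1 j jJ)/= /g' !eqxx /= -{1}(posneg (g j (X j w))).
  have bE u : \prod_(i in J | i != j) (if i == j then u \o g j else g i) (X i w) =
      \prod_(i in J | i != j) g i (X i w).
    by apply: eq_bigr => i iJ; rewrite -/(g' u i) pE.
  by rewrite !bE mulrBl.
under eq_fun do rewrite gE EFinB.
split; first exact: integrableB.
under eq_Rintegral => w _ do rewrite gE.
rewrite RintegralB// Ep EN.
rewrite !(bigD1 j jJ)/= /g' !eqxx /=.
have bE u : \prod_(i in J | i != j) \int[P]_w ((if i == j then u \o g j else g i) (X i w)) =
      \prod_(i in J | i != j) \int[P]_w (g i (X i w)).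
  by apply: eq_bigr => i iJ; rewrite -/(g' u i) pE.
rewrite !bE -mulrBl; congr (_ * _).
have iu (u : R -> R) : measurable_fun setT u -> (forall x, 0 <= u x <= `|x|) ->
    P.-integrable setT (fun w => (u (g j (X j w)))%:E).
  move=> mu u0; apply: le_integrable (ig _ jJ) => //.
    apply/measurable_EFinP; exact: (measurableT_comp mu
        (measurableT_comp (mg j) (measurable_funPT (X j)))).
  move=> w _ /=; rewrite lee_fin ger0_norm; first exact: (andP (u0 _)).2.
  exact: (andP (u0 _)).1.
rewrite -RintegralB//; first by apply: eq_Rintegral => w _; rewrite posneg.
- apply: iu; first by apply: measurable_maxr.
  by move=> x; rewrite /pos le_max lexx orbT/= ge_max ler_norm normr_ge0.
- apply: iu; first by apply: measurable_maxr => //; exact: measurable_oppr.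
  by move=> x; rewrite /neg le_max lexx orbT/= ge_max normr_ge0 -normrN ler_norm.
Qed.

End IndependentProducts.

(** * Eigenvalues of real symmetric matrices *)

Section SymmetricSpectrum.
Local Open Scope complex_scope.
Local Open Scope sesquilinear_scope.

Lemma char_poly_conj (F : fieldType) (n : nat) (U D : 'M[F]_n) :
  U \in unitmx -> char_poly (invmx U *m D *m U) = char_poly D.
Proof.
move=> Uu; rewrite /char_poly /char_poly_mx.
have VUE : map_mx polyC (invmx U) *m map_mx polyC U = 1%:M :> 'M[{poly F}]_n.
  by rewrite -map_mxM mulVmx// map_mx1.
have -> : 'X%:M - map_mx polyC (invmx U *m D *m U) =
    map_mx polyC (invmx U) *m ('X%:M - map_mx polyC D) *m map_mx polyC U.
  by rewrite mulmxBr mulmxBl !map_mxM mul_mx_scalar -scalemxAl VUE scalemx1.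
by rewrite !det_mulmx mulrAC -det_mulmx VUE det1 mul1r.
Qed.

Lemma mx_conj_exp (F : fieldType) (n : nat) (U D : 'M[F]_n) (k : nat) :
  U \in unitmx -> (invmx U *m D *m U) ^+ k = invmx U *m (D ^+ k) *m U.
Proof.
move=> Uu; elim: k => [|k IH]; first by rewrite !expr0 mulmx1 mulVmx.
by rewrite !exprS -!mulmxE IH -!mulmxA mulKVmx.
Qed.

Lemma map_mx_exp (S S' : comNzRingType) (f : {rmorphism S -> S'}) (n : nat)
    (A : 'M[S]_n) (k : nat) : map_mx f (A ^+ k) = map_mx f A ^+ k.
Proof.
elim: k => [|k IH]; first by rewrite !expr0 map_mx1.
by rewrite !exprS -!mulmxE map_mxM IH.
Qed.

Lemma diag_mx_exp (S : comNzRingType) (n : nat) (d : 'rV[S]_n) (k : nat) :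
  diag_mx d ^+ k = diag_mx (\row_i (d 0 i ^+ k)).
Proof.
elim: k => [|k IH].
  by rewrite expr0; apply/matrixP => i j; rewrite !mxE expr0.
rewrite exprS -mulmxE IH mulmx_diag; congr diag_mx; apply/rowP => i.
by rewrite !mxE exprS.
Qed.

Section Diagonalized.
Context (F1 F2 : fieldType) (f : {rmorphism F1 -> F2}) (n : nat).
Context (A : 'M[F1]_n) (U : 'M[F2]_n) (x : 'I_n -> F1).
Hypothesis Uu : U \in unitmx.
Hypothesis AE : map_mx f A = invmx U *m diag_mx (\row_i f (x i)) *m U.

Lemma diagonalized_exp_diag k a :
  f ((A ^+ k) a a) = \sum_i f (x i ^+ k) * (invmx U a i * U i a).
Proof.
have : map_mx f (A ^+ k) = invmx U *m diag_mx (\row_i f (x i ^+ k)) *m U.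
  rewrite map_mx_exp AE mx_conj_exp// diag_mx_exp.
  by congr (_ *m diag_mx _ *m _); apply/rowP => i; rewrite !mxE rmorphXn.
move=> /matrixP/(_ a a); rewrite !mxE => ->.
by apply: eq_bigr => i _; rewrite mul_mx_diag !mxE mulrCA mulrA.
Qed.

Lemma diagonalized_char_poly : char_poly A = \prod_(i < n) ('X - (x i)%:P).
Proof.
apply: (map_inj_poly (fmorph_inj f)); first by rewrite rmorph0.
rewrite map_char_poly AE char_poly_conj// char_poly_trig; last exact: diag_mx_is_trig.
rewrite rmorph_prod; apply: eq_bigr => i _.
by rewrite !mxE eqxx rmorphB /= map_polyX map_polyC.
Qed.

End Diagonalized.

(** Over [R[i]] the matrix is Hermitian, so its spectral values are real and taking real parts loses
    nothing. Only [U] is complex, which is why the preceding lemmas work along a morphism of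
    fields. *)
Lemma symmetric_diagonalization (R : rcfType) (n : nat) (A : 'M[R]_n) :
  A^T = A -> exists (U : 'M[R[i]]_n) (x : 'I_n -> R), U \is unitarymx /\
    map_mx (real_complex R) A =
      invmx U *m diag_mx (\row_i (x i)%:C) *m U.
Proof.
move=> Asym; set B := map_mx _ A.
have Breal : B \is a realmx.
  by apply/mxOverP => i j; rewrite !mxE realE !lecR; exact: num_real.
have Bsym : B \is symmetricmx.
  apply/is_hermitianmxP; rewrite expr0 scale1r; apply/matrixP => i j.
  by rewrite !mxE /= -{1}Asym mxE.
have Bherm := realsym_hermsym Bsym Breal.
have /orthomx_spectralP BE := hermitian_normalmx Bherm.
exists (spectralmx B), (fun i => complex.Re (spectral_diag B 0 i)).
split; first exact: spectral_unitarymx.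
have -> : \row_i (complex.Re (spectral_diag B 0 i))%:C = spectral_diag B.
  apply/rowP => i; rewrite mxE RRe_real//.
  by have /mxOverP/(_ 0 i) := hermitian_spectral_diag_real Bherm.
exact: BE.
Qed.

(** The spectral measure of the coordinate vector [e_a] gives mass [W i a] to
    the [i]-th eigenvalue. *)
Lemma symmetric_spectral_measures (R : realType) (n : nat) (A : 'M[R]_n) :
  A^T = A -> exists W : 'I_n -> 'I_n -> R,
    [/\ forall i a, 0 <= W i a, forall i, \sum_a W i a = 1,
        forall a, \sum_i W i a = 1 &
        forall k a, (A ^+ k) a a = \sum_i W i a * (tnth (eigenvalues A) i) ^+ k].
Proof.
move=> Asym; have [U [x [Uu AE]]] := symmetric_diagonalization Asym.
have Uun : U \in unitmx := unitarymx_unit Uu.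
(* The two families of sums equal to 1 are the two halves of unitarity, read on the diagonals of U
   U^* and U^* U. *)
pose W i a := complex.Re (`|U i a| ^+ 2).
have WE i a : (W i a)%:C = U i a * (U i a)^*%R.
  by rewrite -normCK /W RRe_real// realX// normr_real.
have W0 i a : 0 <= W i a by rewrite -ler0c WE -normCK exprn_ge0.
have sumr i : \sum_a W i a = 1.
  apply: (@complexI R); rewrite rmorph_sum /= rmorph1.
  have /matrixP/(_ i i) := unitarymxP Uu; rewrite !mxE eqxx mulr1n => <-.
  by apply: eq_bigr => a _; rewrite !mxE WE.
have sumc a : \sum_i W i a = 1.
  apply: (@complexI R); rewrite rmorph_sum /= rmorph1.
  have : invmx U *m U = 1%:M by rewrite mulVmx.
  rewrite invmx_unitary// => /matrixP/(_ a a); rewrite !mxE eqxx mulr1n => <-.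
  by apply: eq_bigr => i _; rewrite !mxE WE mulrC.
have AX k a : (A ^+ k) a a = \sum_i W i a * x i ^+ k.
  apply: (@complexI R); rewrite (diagonalized_exp_diag Uun AE) rmorph_sum.
  apply: eq_bigr => i _; rewrite rmorphM mulrC /= WE invmx_unitary// !mxE.
  by rewrite (mulrC (U i a)).
have charE := diagonalized_char_poly Uun AE.
pose t := [tuple x i | i < n].
have tE : char_poly A = \prod_(y <- t) ('X - y%:P) by rewrite charE big_map big_enum.
have [_ eigE] : [set s : n.-tuple R | sorted >=%R s /\
    char_poly A = \prod_(y <- s) ('X - y%:P)] (eigenvalues A).
  apply: xgetPex; exists (sort_tuple >=%R t); split => /=.
    by apply: sort_sorted => y z; exact: ge_total.
  by rewrite tE; apply: perm_big; rewrite perm_sym perm_sort.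
(* [eigenvalues] is sorted while [x] follows the diagonalization. Both list the roots of the
   characteristic polynomial, so a permutation [s] relates them and relabels the weights. *)
have /tuple_permP[s sE] : perm_eq (eigenvalues A) t.
  by apply: prod_XsubC_eq; rewrite -tE.
have nthE i : tnth (eigenvalues A) i = x (s i).
  have -> : eigenvalues A = [tuple tnth t (s i) | i < n] by apply: val_inj.
  by rewrite !tnth_mktuple.
exists (fun i a => W (s i) a); split => //.
- by move=> a; rewrite -(sumc a) [RHS](reindex_inj (@perm_inj _ s)).
- move=> k a; rewrite AX (reindex_inj (@perm_inj _ s)).
  by apply: eq_bigr => i _; rewrite nthE.
Qed.

End SymmetricSpectrum.

(** * Polynomial approximation of min(x^2, c) *)

Section TruncatedSquare.
Context (R : realType).

(* Newton-like iteration [q + (x^2 - q^2) / 2], which increases to [|x|] on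
   [-1, 1] with error at most [2 / n]. *)
Fixpoint abs_poly (n : nat) : {poly R} :=
  if n is m.+1 then abs_poly m + 2^-1 *: ('X^2 - abs_poly m ^+ 2) else 0.

(** The third bound is the error 2/n in a form that makes sense at x = 0 and is inductive: with y =
    |x|, a step multiplies the error by 1 - (y + q)/2 <= 1 - y/2, and (1 - y/2)(1 + (n+1)y/2) <= 1 +
    ny/2. *)
Lemma abs_poly_bound (n : nat) (x : R) : `|x| <= 1 ->
  [/\ 0 <= (abs_poly n).[x], (abs_poly n).[x] <= `|x| &
      (`|x| - (abs_poly n).[x]) * (1 + n%:R * `|x| / 2) <= `|x|].
Proof.
move=> x1; elim: n => [|n [q0 qx IH]] /=.
  by rewrite horner0 !mul0r addr0 mulr1 subr0 lexx normr_ge0.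
rewrite !hornerE /= -(real_normK (num_real x)).
have x0 := normr_ge0 x.
set y := `|x| in x0 x1 qx IH *; set q := (abs_poly n).[x] in q0 qx IH *.
have nx : 0 <= n%:R * y by rewrite mulr_ge0.
split.
- by nra.
- by nra.
have -> : n.+1%:R * y = n%:R * y + y by rewrite -natr1 mulrDl mul1r.
set z := n%:R * y in nx IH *.
apply: le_trans IH.
have e0 : 0 <= y - q by lra.
have -> : y - (q + 2^-1 * (y ^+ 2 - q ^+ 2)) = (y - q) * (1 - (y + q) / 2) by field.
rewrite -mulrA ler_wpM2l//.
nra.
Qed.

(** This approximates min(x^2, c) = (x^2 + c - |u|)/2, where u = x^2 - c. Dividing u by n brings it
    into [-1, 1] for large n; multiplying back by n costs a factor n, so n^2 iterations leave an
    error O(1/n). *)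
Definition trunc_sqr_poly (c : R) (n : nat) : {poly R} :=
  2^-1 *: ('X^2 + c%:P - n%:R *: (abs_poly (n ^ 2) \Po (n%:R^-1 *: ('X^2 - c%:P)))).

Lemma trunc_sqr_poly_cvg (c x : R) :
  (trunc_sqr_poly c n).[x] @[n --> \oo] --> Num.min (x ^+ 2) c.
Proof.
apply/cvgrPdist_le => eps eps0.
near=> n.
have n0 : 0 < n%:R :> R by rewrite ltr0n; near: n; exact: nbhs_infty_gt.
have un : `|x ^+ 2 - c| <= n%:R by near: n; exact: nbhs_infty_ger.
have en : eps^-1 <= n%:R by near: n; exact: nbhs_infty_ger.
rewrite /trunc_sqr_poly !(hornerE, horner_comp) /=.
set u := x ^+ 2 - c in un *.
have u1 : `|n%:R^-1 * u| <= 1.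
  by rewrite normrM normfV (ger0_norm (ltW n0)) [_^-1 * _]mulrC ler_pdivrMr ?mul1r.
have [q0 qx qe] := abs_poly_bound (n ^ 2) u1.
have minE : Num.min (x ^+ 2) c = 2^-1 * (x ^+ 2 + c - `|u|).
  rewrite /u; have [h|h] := leP (x ^+ 2) c.
    by rewrite ler0_norm ?subr_le0//; lra.
  by rewrite gtr0_norm ?subr_gt0//; lra.
rewrite minE.
have uE : `|u| = n%:R * `|n%:R^-1 * u|.
  by rewrite normrM gtr0_norm ?invr_gt0// mulVKf// gt_eqF.
rewrite {}uE.
set y := `|n%:R^-1 * u| in qx qe u1 *; set q := (abs_poly _).[_] in q0 qx qe *.
have y0 : 0 <= y by rewrite normr_ge0.
rewrite (_ : _ - _ = - (2^-1 * n%:R * (y - q))); last by rewrite /y /q; ring.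
rewrite normrN ger0_norm; last by rewrite !mulr_ge0 ?subr_ge0// ltW.
rewrite natrX in qe.
have n2 : n%:R * (n%:R * (y - q)) <= 2.
  have [yE|yN] := eqVneq y 0.
    have -> : y - q = 0 by lra.
    by rewrite !mulr0.
  have yp : 0 < y by rewrite lt_neqAle eq_sym yN.
  rewrite -(ler_pM2r yp).
  set nn := n%:R ^+ 2 in qe.
  have -> : n%:R * (n%:R * (y - q)) * y = (y - q) * (nn * y / 2) * 2.
    by rewrite /nn; field.
  by rewrite mulrDr mulr1 in qe; lra.
have : n%:R * (2^-1 * n%:R * (y - q)) <= n%:R * eps.
  have : 1 <= n%:R * eps by rewrite -ler_pdivrMr// div1r.
  lra.
by rewrite ler_pM2l.
Unshelve. all: by end_near. Qed.

End TruncatedSquare.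

(** * Measurability and bounds of truncated spectral sums *)

Section SpectralStatistics.
Context (R : realType) (d : measure_display) (Omega : measurableType d) (n : nat).

Lemma measurable_mx_exp (A : Omega -> 'M[R]_n) (k : nat) (a b : 'I_n) :
  (forall a b, measurable_fun setT (fun w => A w a b)) ->
  measurable_fun setT (fun w => (A w ^+ k) a b).
Proof.
move=> mA; elim: k a b => [|k IH] a b.
  by under eq_fun do rewrite expr0; exact: measurable_cst.
under eq_fun do rewrite exprS -mulmxE mxE.
by apply: measurable_sum => c /=; apply: measurable_funM; [exact: mA|exact: IH].
Qed.

(* For a polynomial in place of [min(x^2, c)] the sum is a combination of traces
   of powers of [A w]; hence no measurability of single eigenvalues is needed. *)
Lemma measurable_sum_trunc_sqr_eigenvalues (A : Omega -> 'M[R]_n) (c : R) :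
  (forall a b, measurable_fun setT (fun w => A w a b)) ->
  (forall w, (A w)^T = A w) ->
  measurable_fun setT
    (fun w => \sum_i Num.min (tnth (eigenvalues (A w)) i ^+ 2) c).
Proof.
move=> mA Asym.
apply: (@measurable_fun_cvg _ _ _ _
  (fun m w => \sum_i (trunc_sqr_poly c m).[tnth (eigenvalues (A w)) i])).
  move=> m; set q := trunc_sqr_poly c m.
  have E w : \sum_i q.[tnth (eigenvalues (A w)) i] =
      \sum_(k < size q) q`_k * \sum_a (A w ^+ k) a a.
    have [W [_ W1 _ AW]] := symmetric_spectral_measures (Asym w).
    under eq_bigr => i _ do rewrite horner_coef.
    rewrite exchange_big; apply: eq_bigr => k _ /=.
    rewrite -mulr_sumr; congr (_ * _).
    under [RHS]eq_bigr => a _ do rewrite AW.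
    rewrite exchange_big; apply: eq_bigr => i _ /=.
    by rewrite -mulr_suml W1 mul1r.
  under eq_fun do rewrite E.
  apply: measurable_sum => k; apply: measurable_funM => //.
  by apply: measurable_sum => a; exact: measurable_mx_exp.
move=> w _; elim: (index_enum _) => [|i s IH].
  by under eq_fun do rewrite big_nil; rewrite big_nil; exact: cvg_cst.
under eq_fun do rewrite big_cons; rewrite big_cons.
by apply: cvgD => //; exact: trunc_sqr_poly_cvg.
Qed.

(* Jensen for the concave map [y |-> min(y, c)] and the spectral measure of
   [e_a], whose second moment is the diagonal entry of [A ^+ 2]. *)
Lemma sum_trunc_sqr_eigenvalues_le (A : 'M[R]_n) (c : R) : A^T = A ->
  \sum_i Num.min (tnth (eigenvalues A) i ^+ 2) c <=
  \sum_a Num.min ((A ^+ 2) a a) c.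
Proof.
move=> Asym; have [W [W0 W1 W2 AW]] := symmetric_spectral_measures Asym.
under eq_bigr => i _ do rewrite -[Num.min _ _]mul1r -(W1 i) mulr_suml.
rewrite exchange_big; apply: ler_sum => a _ /=; rewrite le_min AW; apply/andP; split.
  by apply: ler_sum => i _; rewrite ler_wpM2l// ge_min lexx.
rewrite -[leRHS]mul1r -(W2 a) mulr_suml.
by apply: ler_sum => i _; rewrite ler_wpM2l// ge_min lexx orbT.
Qed.

Lemma Rintegral_esd (A : 'M[R]_n) (f : R -> R) :
  measurable_fun setT f -> (forall x, 0 <= f x) ->
  \int[esd A]_x f x = n%:R^-1 * \sum_i f (tnth (eigenvalues A) i).
Proof.
move=> mf f0; have mEf : measurable_fun setT (EFin \o f) by exact/measurable_EFinP.
rewrite /Rintegral /esd ge0_integral_mscale//=; last by move=> x _; rewrite lee_fin.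
rewrite ge0_integral_measure_sum//; last by move=> x _; rewrite lee_fin.
rewrite (eq_bigr (fun i : 'I_n => (f (tnth (eigenvalues A) i))%:E)).
  by rewrite sumEFin -EFinM.
by move=> i _; rewrite integral_dirac// diracT mul1e (tnth_nth 0).
Qed.

End SpectralStatistics.

(** * The second moment [eta_2] *)

Section OneHyperedge.
Context (p : nat).

Definition one_hyperedge (o : 'I_p) : fat_hypergraph p 2 :=
  ([ffun e : {set 'I_p} => if e == [set: 'I_p]%SET then (inord 2 : 'I_3) else ord0], o).

Lemma multiplicity_one_hyperedge o e :
  multiplicity (one_hyperedge o) e = if e == [set: 'I_p]%SET then 2 else 0.
Proof. by rewrite /multiplicity ffunE; case: eqP => //; rewrite inordK. Qed.

Lemma hyperedges_one_hyperedge o :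
  hyperedges (one_hyperedge o) = [set [set: 'I_p]]%SET.
Proof.
apply/setP => e; rewrite !inE multiplicity_one_hyperedge.
by case: (e == _).
Qed.

Lemma one_hyperedge_fat_hypertree o : is_fat_hypertree p (one_hyperedge o).
Proof.
have hE := hyperedges_one_hyperedge o.
have eT e : e \in hyperedges (one_hyperedge o) -> e = [set: 'I_p]%SET.
  by rewrite hE inE => /eqP.
have Tin : [set: 'I_p]%SET \in hyperedges (one_hyperedge o) by rewrite hE inE.
pose v0 : {e | e \in hyperedges (one_hyperedge o)} :=
  exist (fun e => e \in hyperedges (one_hyperedge o)) [set: 'I_p]%SET Tin.
split.
- by move=> e /eT ->; rewrite cardsT card_ord.
- have sub (v : {e | e \in hyperedges (one_hyperedge o)}) : v = v0.
    by apply: val_inj => /=; exact: eT (valP v).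
  have adjl i v : incidence (H := one_hyperedge o) (inl i) (inr v).
    by rewrite /= (sub v) inE.
  have adjr i v : incidence (H := one_hyperedge o) (inr v) (inl i).
    by rewrite /= (sub v) inE.
  split.
    move=> [i|u] [j|v].
    - exact: (connect_trans (connect1 (adjl i v0)) (connect1 (adjr j _))).
    - exact: connect1.
    - exact: connect1.
    - by rewrite (sub u) (sub v) connect0.
  have uu (v v' : {e | e \in hyperedges (one_hyperedge o)}) : v = v' by rewrite (sub v) (sub v').
  (* The incidence graph is a star. Neighbours lie on opposite sides, so a cycle of length at least
     three would visit the only hyperedge twice or close up between two vertices of the same
     side. *)
  move=> [|[i|u] [|[j|v] [|[k|z] s]]] //= _; rewrite /ucycleb /=.
  + case: s => [|[t|t] s] /=; rewrite ?andbF//.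
    by rewrite (uu t v) !inE !eqxx /= ?orbT /= ?andbF.
  + by rewrite !andbF.
  + by rewrite !andbF.
  + by rewrite (uu z u) !inE !eqxx /= ?orbT /= ?andbF.
- by move=> e /eT ->; rewrite multiplicity_one_hyperedge eqxx.
- by rewrite hE big_set1 multiplicity_one_hyperedge eqxx.
Qed.

End OneHyperedge.

Section Isomorphism.
Context (n k : nat).
Implicit Types H : fat_hypergraph n k.

Lemma isomorphic_refl H : isomorphic H H.
Proof.
apply/existsP; exists 1%g; rewrite /isomorphism perm1 eqxx /=; apply/forallP => e.
by rewrite (eq_imset (g := id)) ?imset_id// => x; rewrite perm1.
Qed.

Lemma isomorphic_sym H H' : isomorphic H H' -> isomorphic H' H.
Proof.
move=> /existsP[s /andP[/eqP so /forallP sm]]; apply/existsP; exists s^-1%g.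
rewrite /isomorphism -so permK eqxx /=; apply/forallP => e.
rewrite -(eqP (sm _)) -imset_comp (eq_imset (g := id)) ?imset_id//.
by move=> x /=; rewrite permKV.
Qed.

Lemma isomorphic_trans H1 H2 H3 :
  isomorphic H1 H2 -> isomorphic H2 H3 -> isomorphic H1 H3.
Proof.
move=> /existsP[s /andP[/eqP so /forallP sm]] /existsP[t /andP[/eqP to /forallP tm]].
apply/existsP; exists (s * t)%g; rewrite /isomorphism permM so to eqxx /=.
apply/forallP => e; rewrite -(eqP (sm _)) -(eqP (tm _)) -imset_comp.
by rewrite (eq_imset (g := t \o s))// => x; rewrite permM.
Qed.

Lemma isomorphic_equivalence (D : {set fat_hypergraph n k}) :
  {in D & &, equivalence_rel (@isomorphic n k)}.
Proof.
move=> H1 H2 H3 _ _ _; split; first exact: isomorphic_refl.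
move=> H12; apply/idP/idP; last exact: isomorphic_trans.
exact: isomorphic_trans (isomorphic_sym H12).
Qed.

Lemma iso_representativesP (p : nat) H : is_fat_hypertree p H ->
  exists2 H', H' \in iso_representatives n k p & isomorphic H H'.
Proof.
move=> treeH; set D := @fat_hypertrees n k p.
have HD : H \in D by rewrite inE; apply/asboolP.
have eqD := @isomorphic_equivalence D.
have part := equivalence_partitionP eqD.
have trans := transversalP part.
have Hcov : H \in finset.cover (equivalence_partition (@isomorphic n k) D).
  by rewrite (cover_partition part).
have Bin := pblock_mem Hcov.
exists (transversal_repr H (iso_representatives n k p)
  (finset.pblock (equivalence_partition (@isomorphic n k) D) H)).
  exact: repr_mem_transversal trans _ _ Bin.
have X_D := fintype.subsetP (transversal_sub trans) _ (repr_mem_transversal trans H Bin).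
rewrite -(pblock_equivalence_partition eqD HD X_D).
exact: repr_mem_pblock trans _ _ Bin.
Qed.

Lemma iso_representatives_sub (p : nat) H :
  H \in iso_representatives n k p -> is_fat_hypertree p H.
Proof.
set D := @fat_hypertrees n k p.
have part := equivalence_partitionP (@isomorphic_equivalence D).
have /fintype.subsetP sub := transversal_sub (transversalP part).
by move=> /sub; rewrite inE => /asboolP.
Qed.

End Isomorphism.

Lemma fat_hypertree2_multiplicity (n p : nat) (H : fat_hypergraph n 2) e :
  is_fat_hypertree p H -> e \in hyperedges H -> multiplicity H e = 2.
Proof.
case=> _ _ ge2 sum2 eH; apply/eqP; rewrite eqn_leq ge2// andbT.
by rewrite -[X in (_ <= X)%N]sum2 (bigD1 e)//= leq_addr.
Qed.

Lemma weight2_ge0 (R : realType) (n p : nat) (a : nat -> R) (H : fat_hypergraph n 2) :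
  0 <= a 2 -> is_fat_hypertree p H -> 0 <= weight a H.
Proof.
move=> a2 treeH; rewrite /weight mulr_ge0 ?invr_ge0//; apply: sumr_ge0 => w.
rewrite inE => /and3P[_ _ /forallP wH]; apply: prodr_ge0 => e eH.
by have /implyP/(_ eH)/eqP -> := wH e; rewrite (fat_hypertree2_multiplicity treeH).
Qed.

Lemma perm_imset_setT (T : finType) (s : {perm T}) (e : {set T}) :
  (s @: e == [set: T])%SET = (e == [set: T]%SET).
Proof.
by rewrite !eqEcard !finset.subsetT card_imset//; exact: perm_inj.
Qed.

(** The transversal picks an unspecified member of the isomorphism class, so the class must be
    known: a permutation fixes the full vertex set and can only move the root. *)
Lemma isomorphic_one_hyperedge (p : nat) (o : 'I_p) (H : fat_hypergraph p 2) :
  isomorphic (one_hyperedge o) H -> exists o', H = one_hyperedge o'.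
Proof.
move=> /existsP[s /andP[_ /forallP sm]]; exists (root_vertex H).
have HE e : multiplicity H e = multiplicity (one_hyperedge (root_vertex H)) e.
  have -> : e = (s @: (s^-1%g @: e))%SET.
    rewrite -imset_comp (eq_imset (g := id)) ?imset_id// => x /=.
    by rewrite permKV.
  rewrite (eqP (sm _)) !multiplicity_one_hyperedge.
  by rewrite (perm_imset_setT s).
case: H HE {sm} => m r HE; congr pair; apply/ffunP => e; apply: val_inj.
exact: HE.
Qed.

(** The p - 1 walks from [o] to another vertex and back contribute (p-2)! each, and the
    automorphisms are the (p-1)! permutations fixing [o]; the quotient is 1. *)
Lemma weight_one_hyperedge (R : realType) (p : nat) (o : 'I_p) (a : nat -> R) :
  (2 <= p)%N -> a 2 = (p - 2)`!%:R -> 1 <= weight a (one_hyperedge o).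
Proof.
move=> p2 a2; rewrite /weight.
have -> : #|Aut (one_hyperedge o)| = (p - 1)`!.
  transitivity #|[set s | perm_on [set~ o] s]%SET|.
    apply: eq_card => s; rewrite !inE /isomorphism /=.
    have -> : [forall e : {set 'I_p}, multiplicity (one_hyperedge o) (s @: e)%SET ==
        multiplicity (one_hyperedge o) e].
      by apply/forallP => e; rewrite !multiplicity_one_hyperedge perm_imset_setT.
    rewrite andbT; apply/eqP/idP => [so|/out_perm -> //]; last by rewrite !inE eqxx.
    by apply/fintype.subsetP => x; rewrite !inE; apply: contra => /eqP ->; rewrite so.
  by rewrite cardsE card_perm cardsC1 card_ord subn1.
have stepsE (w : 2.-tuple 'I_p) : steps_in (one_hyperedge o) w [set: 'I_p]%SET = 2.
  case: w => [[|x [|y [|]]] //= w].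
  by rewrite /steps_in /= !inE.
rewrite hyperedges_one_hyperedge.
under eq_bigr => w _ do rewrite big_set1 stepsE a2.
rewrite sumr_const.
have cw : (p - 1 <= #|closed_walks (one_hyperedge o)|)%N.
  have -> : (p - 1)%N = #|[set~ o]%SET| by rewrite cardsC1 card_ord subn1.
  have inj : injective (fun x : 'I_p => [tuple x; o]) by move=> x y [].
  rewrite -(card_imset _ inj); apply/subset_leq_card/fintype.subsetP => w /imsetP[x].
  rewrite !inE => xo ->; rewrite /= eqxx /clique_adj xo eq_sym xo /=.
  have T y z : [exists e in hyperedges (one_hyperedge o), (y \in e) && (z \in e)].
    by apply/existsP; exists [set: 'I_p]%SET; rewrite hyperedges_one_hyperedge !inE eqxx.
  rewrite !T /=; apply/forallP => e; apply/implyP.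
  rewrite hyperedges_one_hyperedge inE => /eqP ->.
  by rewrite stepsE multiplicity_one_hyperedge eqxx.
rewrite ler_pdivlMl ?mulr1 ?ltr0n ?fact_gt0//.
rewrite -[leRHS]mulr_natr -natrM ler_nat.
have -> : (p - 1)%N = (p - 2).+1 by rewrite -subSn.
by rewrite factS mulnC leq_mul2l -subSn// cw orbT.
Qed.

(** Total multiplicity two forces each hyperedge to have multiplicity exactly two. Hence only [a 2]
    enters, all terms are nonnegative, and the one-hyperedge class alone gives the bound. *)
Lemma eta2_ge1 (R : realType) (p : nat) (a : nat -> R) :
  (2 <= p)%N -> a 2 = (p - 2)`!%:R -> 1 <= eta p a 2.
Proof.
move=> p2 a2; have a20 : 0 <= a 2 by rewrite a2.
have pn : (p < (1 + 2 * p).+1)%N by rewrite ltnS mul2n -addnn addnA leq_addl.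
have o : 'I_p by apply: (@Ordinal _ 0); exact: ltnW.
have [H Hin /isomorphic_one_hyperedge[r HE]] :=
  iso_representativesP (one_hyperedge_fat_hypertree o).
rewrite /eta /= (bigD1 (Ordinal pn))//= (bigD1 H)//=.
apply: le_trans (weight_one_hyperedge r p2 a2) _.
rewrite -HE -addrA lerDl addr_ge0//; apply: sumr_ge0.
  by move=> G /andP[/iso_representatives_sub Gt _]; exact: weight2_ge0 Gt.
by move=> m _; apply: sumr_ge0 => G /iso_representatives_sub Gt; exact: weight2_ge0 Gt.
Qed.

(** * Change of measure by a product density *)

Section FiniteSums.
Context (R : realType) (d : measure_display) (Omega : measurableType d).
Context (P : probability Omega R).

Lemma integrableDR (f g : Omega -> R) :
  P.-integrable setT (EFin \o f) -> P.-integrable setT (EFin \o g) ->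
  P.-integrable setT (EFin \o (fun w => f w + g w)).
Proof.
move=> fi gi; have -> : EFin \o (fun w => f w + g w) = (EFin \o f) \+ (EFin \o g).
  by apply/funext => w; rewrite /= EFinD.
exact: integrableD.
Qed.

Lemma integrableZR (c : R) (f : Omega -> R) : P.-integrable setT (EFin \o f) ->
  P.-integrable setT (EFin \o (fun w => c * f w)).
Proof.
move=> fi; have -> : EFin \o (fun w => c * f w) = (fun w => c%:E * (EFin \o f) w)%E.
  by apply/funext => w; rewrite /= EFinM.
exact: integrableZl.
Qed.

Lemma integrable_sumR (I : Type) (s : seq I) (Q : pred I) (F : I -> Omega -> R) :
  (forall i, Q i -> P.-integrable setT (EFin \o F i)) ->
  P.-integrable setT (EFin \o (fun w => \sum_(i <- s | Q i) F i w)).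
Proof.
move=> iF; have -> : EFin \o (fun w => \sum_(i <- s | Q i) F i w) =
    (fun w => \sum_(i <- s | Q i) (EFin \o F i) w)%E.
  by apply/funext => w; rewrite /= sumEFin.
exact: integrable_sum.
Qed.

Lemma Rintegral_sum (I : Type) (s : seq I) (Q : pred I) (F : I -> Omega -> R) :
  (forall i, Q i -> P.-integrable setT (EFin \o F i)) ->
  \int[P]_w (\sum_(i <- s | Q i) F i w) = \sum_(i <- s | Q i) \int[P]_w F i w.
Proof.
move=> iF; elim: s => [|i s IH].
  under eq_Rintegral => w _ do rewrite big_nil.
  by rewrite big_nil Rintegral_cst// mul0r.
under eq_Rintegral => w _ do rewrite big_cons.
rewrite big_cons; case: ifP => Qi //.
by rewrite RintegralD ?IH//; [exact: iF|exact: integrable_sumR].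
Qed.

End FiniteSums.

Section SymmetricTensor.
Context (R : realType) (d : measure_display) (Omega : measurableType d).
Context (P : probability Omega R) (p N : nat).
Context (T : p.-tuple 'I_N -> {RV P >-> R}).
Hypothesis T_sym : forall i j : p.-tuple 'I_N, perm_eq i j -> T i =1 T j.
Hypothesis T_indep : mutually_independent (@nondecreasing_index N p) T.

(** Canonical representative of an orbit of indices under permutation; the entries at these
    representatives are the independent ones. *)
Definition sort_index (i : p.-tuple 'I_N) : p.-tuple 'I_N :=
  sort_tuple (fun x y : 'I_N => (x <= y)%N) i.

Lemma sort_index_nondecreasing i : nondecreasing_index (sort_index i).
Proof.
rewrite /nondecreasing_index sorted_map.
by apply: (@sort_sorted _ (fun x y : 'I_N => (x <= y)%N)) => x y; exact: leq_total.
Qed.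

Lemma perm_sort_index i : perm_eq (sort_index i) i.
Proof. by rewrite perm_sort. Qed.

Lemma eq_sort_index i j : (sort_index i == sort_index j) = perm_eq i j.
Proof.
pose le (x y : 'I_N) := (x <= y)%N.
have le_total : total le by move=> x y; exact: leq_total.
have le_trans : transitive le by move=> x y z; exact: leq_trans.
have le_anti : antisymmetric le by move=> x y /anti_leq/val_inj.
by rewrite -val_eqE; apply/eqP/(perm_sortP le_total le_trans le_anti).
Qed.

Lemma T_sort_index i : T (sort_index i) =1 T i.
Proof. exact/T_sym/perm_sort_index. Qed.

Definition sorted_indices : {set p.-tuple 'I_N} :=
  [set i | nondecreasing_index i]%SET.

Section Tilt.
Context (y : p.-tuple 'I_N -> R -> R).
Hypothesis y_measurable : forall k, measurable_fun setT (y k).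
Hypothesis y_ge0 : forall k x, 0 <= y k x.
Hypothesis y_integrable : forall k n, (n <= 2)%N ->
  P.-integrable setT (fun w => (T k w ^+ n * y k (T k w))%:E).
Hypothesis y_gt0 : forall k, 0 < \int[P]_w y k (T k w).

(* [tilt / tilt_mass] is the density of a measure under which the [T k] are still
   independent, with moments [tilt_moment n k]. *)
Definition tilt w := \prod_(k in sorted_indices) y k (T k w).
Definition tilt_mass : R := \prod_(k in sorted_indices) \int[P]_w y k (T k w).
Definition tilt_moment n k : R :=
  (\int[P]_w (T k w ^+ n * y k (T k w))) / \int[P]_w y k (T k w).

Let sorted_sub : {subset sorted_indices <= @nondecreasing_index N p}.
Proof. by move=> k; rewrite inE. Qed.

(** The difference is the variance of [T k] under the tilted measure. *)
Lemma tilt_moment_ge0 k : 0 <= tilt_moment 2 k - tilt_moment 1 k ^+ 2.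
Proof.
pose mu := \int[P]_w y k (T k w).
have mu0 : 0 < mu by exact: y_gt0.
have i0 := y_integrable k (isT : 0 <= 2)%N.
have i1 := y_integrable k (isT : 1 <= 2)%N.
have i2 := y_integrable k (isT : 2 <= 2)%N.
pose m := tilt_moment 1 k.
have : 0 <= \int[P]_w ((T k w - m) ^+ 2 * y k (T k w)).
  by apply: Rintegral_ge0 => w _; rewrite mulr_ge0// sqr_ge0.
have -> : \int[P]_w ((T k w - m) ^+ 2 * y k (T k w)) =
    \int[P]_w (T k w ^+ 2 * y k (T k w) +
      ((- 2 * m) * (T k w ^+ 1 * y k (T k w)) + m ^+ 2 * (T k w ^+ 0 * y k (T k w)))).
  by apply: eq_Rintegral => w _; ring.
have i1' : P.-integrable setT (EFin \o (fun w => (- 2 * m) * (T k w ^+ 1 * y k (T k w)))).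
  exact: integrableZR.
have i0' : P.-integrable setT (EFin \o (fun w => m ^+ 2 * (T k w ^+ 0 * y k (T k w)))).
  exact: integrableZR.
rewrite RintegralD//; last exact: integrableDR.
rewrite RintegralD// RintegralZl// RintegralZl//.
have -> : \int[P]_w (T k w ^+ 0 * y k (T k w)) = mu.
  by apply: eq_Rintegral => w _; rewrite expr0 mul1r.
have -> : \int[P]_w (T k w ^+ 1 * y k (T k w)) = mu * m.
  by rewrite /m /tilt_moment -/mu mulrC divfK// gt_eqF.
have -> : \int[P]_w (T k w ^+ 2 * y k (T k w)) = mu * tilt_moment 2 k.
  by rewrite /tilt_moment -/mu mulrC divfK// gt_eqF.
rewrite -/m => h.
rewrite -(pmulr_rge0 _ mu0); nra.
Qed.

Lemma expectation_tilt : P.-integrable setT (EFin \o tilt) /\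
  \int[P]_w tilt w = tilt_mass.
Proof.
apply: (expectation_prod T_indep) => // k _.
have := y_integrable k (isT : 0 <= 2)%N.
by under eq_fun do rewrite expr0 mul1r.
Qed.

Lemma expectation_tilt2 i j :
  P.-integrable setT (fun w => (T i w * T j w * tilt w)%:E) /\
  \int[P]_w (T i w * T j w * tilt w) = tilt_mass *
    (if perm_eq i j then tilt_moment 2 (sort_index i)
     else tilt_moment 1 (sort_index i) * tilt_moment 1 (sort_index j)).
Proof.
set a := sort_index i; set b := sort_index j.
have aS : a \in sorted_indices by rewrite inE sort_index_nondecreasing.
have bS : b \in sorted_indices by rewrite inE sort_index_nondecreasing.
(* The exponent of the independent entry [T k] in [T i * T j]; it is 2 exactly when [i] and [j] are
   rearrangements of each other and [k] is their sorted form. *)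
pose e k := ((k == a) + (k == b))%N.
pose g k x := x ^+ e k * y k x.
have e2 k : (e k <= 2)%N by rewrite /e; do 2 case: (_ == _).
have gE w : \prod_(k in sorted_indices) g k (T k w) = T i w * T j w * tilt w.
  rewrite big_split /=; congr (_ * _); rewrite /e.
  under eq_bigr => k _ do rewrite exprD.
  rewrite big_split /=; congr (_ * _).
    rewrite (bigD1 a)//= eqxx expr1 big1 ?mulr1 ?T_sort_index// => k /andP[_ /negPf ->].
    by rewrite expr0.
  rewrite (bigD1 b)//= eqxx expr1 big1 ?mulr1 ?T_sort_index// => k /andP[_ /negPf ->].
  by rewrite expr0.
have [||ig Eg] := expectation_prod T_indep (g := g) sorted_sub.
- move=> k; apply: measurable_funM => //; exact: measurable_funX.
- by move=> k _; exact: y_integrable.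
split; first by under eq_fun do rewrite -gE.
under eq_Rintegral => w _ do rewrite -gE.
rewrite Eg.
have EgE k : \int[P]_w g k (T k w) =
    (\int[P]_w y k (T k w)) * (if e k == 0 then 1 else tilt_moment (e k) k).
  have [e0|_] := eqVneq (e k) 0.
    by rewrite mulr1; apply: eq_Rintegral => w _; rewrite /g e0 mul1r.
  by rewrite /tilt_moment mulrC divfK// gt_eqF.
under eq_bigr => k _ do rewrite EgE.
rewrite big_split /=; congr (_ * _).
rewrite -eq_sort_index -/a -/b; have [ab|ab] := eqVneq a b.
  rewrite (bigD1 a)//= {1 2}/e -ab !eqxx /= big1 ?mulr1// => k /andP[_ /negPf ka].
  by rewrite /e -ab ka.
rewrite (bigD1 a)//= (bigD1 b)/=; last by rewrite bS eq_sym ab.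
have ea : e a = 1%N by rewrite /e eqxx (negPf ab).
have eb : e b = 1%N by rewrite /e eqxx eq_sym (negPf ab).
rewrite ea eb /= big1 ?mulr1// => k /andP[/andP[_ /negPf ka] /negPf kb].
by rewrite /e ka kb.
Qed.

(** Variance plus squared mean under the tilted measure: a covariance survives only between indices
    naming the same entry. In this form every summand is nonnegative, so a lower bound may drop
    terms freely. *)
Lemma expectation_sum_sqr_tilt (J : finType) (f : J -> p.-tuple 'I_N) :
  P.-integrable setT (fun w => ((\sum_j T (f j) w) ^+ 2 * tilt w)%:E) /\
  \int[P]_w ((\sum_j T (f j) w) ^+ 2 * tilt w) = tilt_mass *
    (\sum_i \sum_(j | perm_eq (f i) (f j))
       (tilt_moment 2 (sort_index (f i)) - tilt_moment 1 (sort_index (f i)) ^+ 2) +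
     (\sum_j tilt_moment 1 (sort_index (f j))) ^+ 2).
Proof.
have E w : (\sum_j T (f j) w) ^+ 2 * tilt w =
    \sum_i \sum_j T (f i) w * T (f j) w * tilt w.
  rewrite expr2 mulr_suml mulr_suml; apply: eq_bigr => i _.
  by rewrite mulr_sumr mulr_suml.
have iE i j := (expectation_tilt2 (f i) (f j)).1.
have iE2 i : P.-integrable setT (EFin \o (fun w => \sum_j T (f i) w * T (f j) w * tilt w)).
  by apply: integrable_sumR => j _; exact: iE.
split.
  by under eq_fun do rewrite E; apply: integrable_sumR => i _; exact: iE2.
under eq_Rintegral => w _ do rewrite E.
rewrite Rintegral_sum//.
transitivity (\sum_i \sum_j tilt_mass * (tilt_moment 1 (sort_index (f i)) *
    tilt_moment 1 (sort_index (f j)) + if perm_eq (f i) (f j) then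
    tilt_moment 2 (sort_index (f i)) - tilt_moment 1 (sort_index (f i)) ^+ 2 else 0)).
  apply: eq_bigr => i _; rewrite Rintegral_sum; last by move=> j _; exact: iE.
  apply: eq_bigr => j _; rewrite (expectation_tilt2 (f i) (f j)).2; congr (_ * _).
  case: ifP => [fij|_]; last by rewrite addr0.
  have /eqP -> : sort_index (f j) == sort_index (f i) by rewrite eq_sort_index perm_sym.
  by ring.
under eq_bigr => i _ do rewrite -mulr_sumr big_split /=.
rewrite -mulr_sumr big_split /= addrC; congr (_ * (_ + _)).
  by apply: eq_bigr => i _; rewrite -big_mkcond.
by rewrite expr2 mulr_suml; apply: eq_bigr => i _; rewrite mulr_sumr.
Qed.

End Tilt.

End SymmetricTensor.

(** * Counting tuples with distinct or rearranged entries *)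

Section Counting.

Lemma ffact_leq_expn (N m : nat) : (N ^_ m <= N ^ m)%N.
Proof. by elim: m => // m IH; rewrite ffactnSr expnSr leq_mul ?leq_subr. Qed.

(** Bounds the tuples with a repeated entry: fewer than m^2 pairs of positions can collide, each
    leaving m - 1 free choices. *)
Lemma leq_expn_ffact (N m : nat) : (N ^ m <= N ^_ m + m ^ 2 * N ^ m.-1)%N.
Proof.
elim: m => [|m IH]; first by rewrite ffactn0.
have ffE : (N * N ^_ m <= N ^_ m.+1 + m * N ^ m)%N.
  rewrite ffactnSr; apply: (@leq_trans (N ^_ m * (N - m) + m * N ^_ m)).
    by rewrite mulnC [(m * _)%N]mulnC -mulnDr leq_mul2l; apply/orP; right; lia.
  by rewrite leq_add2l leq_mul2l ffact_leq_expn orbT.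
have mE : (N * (m ^ 2 * N ^ m.-1) = m ^ 2 * N ^ m)%N.
  by case: m {IH ffE} => [|m]; rewrite ?mul0n ?muln0// mulnCA -expnS.
rewrite expnS; apply: (leq_trans (leq_mul (leqnn N) IH)).
rewrite mulnDr mE /=; apply: (leq_trans (leq_add ffE (leqnn _))).
rewrite -addnA leq_add2l -mulnDl leq_mul2r; apply/orP; right.
by rewrite -!mulnn; lia.
Qed.

Lemma card_perm_eq_tuples (T : finType) (m : nat) (t : m.-tuple T) :
  (#|[pred u : m.-tuple T | perm_eq t u]| <= m`!)%N.
Proof.
apply: (@leq_trans #|[seq [tuple tnth t (s i) | i < m] | s : 'S_m]|).
  apply: subset_leq_card; apply/fintype.subsetP => u.
  rewrite inE perm_sym => /tuple_permP[s us]; apply/fintype.imageP; exists s => //.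
  exact: val_inj.
by apply: (leq_trans (leq_image_card _ _)); rewrite card_Sn.
Qed.

Lemma sum_take2 (R : nmodType) (T : finType) (m : nat) (a b : T)
    (F : m.+2.-tuple T -> R) :
  \sum_(i : m.+2.-tuple T | take 2 i == [:: a; b]) F i =
  \sum_(t : m.-tuple T) F [tuple of a :: b :: t].
Proof.
rewrite (reindex_onto (fun t : m.-tuple T => [tuple of a :: b :: t])
  (fun i => [tuple of behead (behead i)])) /=.
  apply: eq_bigl => t; rewrite take0 eqxx /=; apply/eqP; exact: val_inj.
move=> i; case/tupleP: i => x i; case/tupleP: i => z i /= /eqP[-> -> _].
exact: val_inj.
Qed.

Lemma card_uniq_cons2 (T : finType) (m : nat) (a : T) :
  #|[pred bt : T * m.-tuple T | uniq (a :: bt.1 :: bt.2)]| = (#|T|.-1 ^_ m.+1)%N.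
Proof.
have <- : #|predC1 a| = #|T|.-1 by rewrite cardC1.
rewrite -card_uniq_tuples.
have inj : injective (fun bt : T * m.-tuple T => [tuple of bt.1 :: bt.2]).
  by move=> [b t] [b' t'] /= [-> tt]; congr pair; exact: val_inj.
rewrite -(fintype.card_image inj); apply: eq_card => u; rewrite inE.
have -> : all (predC1 a) u && uniq u = uniq (a :: u).
  by rewrite /= -has_pred1 -all_predC; congr (_ && _); apply: eq_all.
apply/fintype.imageP/idP => [[[b t] + ->]|]; first by rewrite inE.
by case/tupleP: u => b t ut; exists (b, t).
Qed.

End Counting.

(** * The polynomial density *)

Section PolynomialTilt.
Context (R : realType) (d : measure_display) (Omega : measurableType d).
Context (P : probability Omega R) (p N : nat).
Context (T : p.+2.-tuple 'I_N -> {RV P >-> R}).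
Hypothesis T_sym : forall i j : p.+2.-tuple 'I_N, perm_eq i j -> T i =1 T j.
Hypothesis T_indep : mutually_independent (@nondecreasing_index N p.+2) T.
Hypothesis T_integrable : forall i k,
  P.-integrable setT (fun w => (T i w ^+ k)%:E).
Hypothesis T_centered : forall i, \int[P]_w (T i w) = 0.

Definition moment i k : R := \int[P]_w (T i w ^+ k).

Lemma moment0 i : moment i 0 = 1.
Proof.
rewrite /moment; under eq_Rintegral => w _ do rewrite expr0.
rewrite Rintegral_cst// mul1r; exact: (congr1 fine (probability_setT P)).
Qed.

Lemma moment1 i : moment i 1 = 0.
Proof. by rewrite -(T_centered i); apply: eq_Rintegral => w _; rewrite expr1. Qed.

Lemma moment_sort_index i k : moment (sort_index i) k = moment i k.
Proof. by apply: eq_Rintegral => w _; rewrite T_sort_index. Qed.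

Lemma moment_even_ge0 i j : 0 <= moment i (2 * j).
Proof. by apply: Rintegral_ge0 => w _; rewrite exprM exprn_ge0// sqr_ge0. Qed.

(** By |x| <= 1 + x^2. An upper bound on odd moments says nothing about very negative ones, so their
    absolute values are controlled by the even moments. *)
Lemma normr_moment_odd i j :
  `|moment i (2 * j + 1)| <= moment i (2 * j) + moment i (2 * j + 2).
Proof.
apply: le_trans (le_normr_Rintegral _ (T_integrable i (2 * j + 1))) _ => //.
rewrite -RintegralD//; last 2 first.
  exact: T_integrable.
  exact: T_integrable.
apply: le_Rintegral => //.
- exact: (integrable_norm (T_integrable i (2 * j + 1))).
- by apply: integrableDR; exact: T_integrable.
move=> w _; rewrite (exprD _ (2 * j) 1) (exprD _ (2 * j) 2) expr1 normrM exprM.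
have x0 : 0 <= T i w ^+ 2 by exact: sqr_ge0.
rewrite (ger0_norm (exprn_ge0 _ x0)) -[X in X + _]mulr1 -mulrDr.
rewrite ler_wpM2l ?(exprn_ge0 _ x0)//.
have := real_normK (num_real (T i w)); have := sqr_ge0 (`|T i w| - 1).
by rewrite sqrrB1 mulr2n; lra.
Qed.

Context (a : 'I_N).

Definition cons_index (bt : 'I_N * p.-tuple 'I_N) : p.+2.-tuple 'I_N :=
  [tuple of a :: bt.1 :: bt.2].

Definition row_sqr w := \sum_b (\sum_t T (cons_index (b, t)) w) ^+ 2.

Lemma row_sqr_ge0 w : 0 <= row_sqr w.
Proof. by apply: sumr_ge0 => b _; exact: sqr_ge0. Qed.

Lemma perm_cons_index b t u :
  perm_eq (cons_index (b, t)) (cons_index (b, u)) = perm_eq t u.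
Proof. by rewrite /= !perm_cons. Qed.

(** The case of the constant density 1: centering removes the squared means, and each [t] has at
    most p! rearrangements. *)
Lemma expectation_row_sqr_le : P.-integrable setT (EFin \o row_sqr) /\
  \int[P]_w row_sqr w <= p`!%:R * \sum_bt moment (cons_index bt) 2.
Proof.
pose y (k : p.+2.-tuple 'I_N) (x : R) : R := 1.
have y_int k n : (n <= 2)%N -> P.-integrable setT (fun w => (T k w ^+ n * y k (T k w))%:E).
  by move=> _; under eq_fun do rewrite mulr1; exact: T_integrable.
have mass1 k : \int[P]_w y k (T k w) = 1.
  by rewrite Rintegral_cst// mul1r; exact: (congr1 fine (probability_setT P)).
have y_gt0 k : 0 < \int[P]_w y k (T k w) by rewrite mass1.
have tilt1 w : tilt T y w = 1 by rewrite /tilt big1.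
have Z1 : tilt_mass T y = 1 by rewrite /tilt_mass big1.
have tm n k : tilt_moment T y n k = moment k n.
  by rewrite /tilt_moment mass1 divr1; apply: eq_Rintegral => w _; rewrite mulr1.
have H b := expectation_sum_sqr_tilt T_sym T_indep (y := y)
  (fun=> measurable_cst _) y_int y_gt0 (fun t => cons_index (b, t)).
have int1 b : P.-integrable setT (EFin \o (fun w => (\sum_t T (cons_index (b, t)) w) ^+ 2)).
  have := (H b).1; congr (integrable _ _ _).
  by apply/funext => w; rewrite tilt1 mulr1.
split; first by apply: integrable_sumR => b _; exact: int1.
rewrite Rintegral_sum//.
have -> : \sum_bt moment (cons_index bt) 2 =
    \sum_b \sum_t moment (cons_index (b, t)) 2.
  by rewrite pair_bigA; apply: eq_bigr => -[b t] _.
rewrite mulr_sumr; apply: ler_sum => b _.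
have -> : \int[P]_w ((\sum_t T (cons_index (b, t)) w) ^+ 2) =
    \int[P]_w ((\sum_t T (cons_index (b, t)) w) ^+ 2 * tilt T y w).
  by apply: eq_Rintegral => w _; rewrite tilt1 mulr1.
rewrite (H b).2 Z1 mul1r.
under [X in _ + X ^+ 2]eq_bigr => t _ do rewrite tm moment_sort_index moment1.
rewrite [X in _ + X ^+ 2]big1// expr0n addr0 mulr_sumr; apply: ler_sum => t _.
under eq_bigl => u do rewrite perm_cons_index.
under eq_bigr => u _ do rewrite !tm !moment_sort_index moment1 expr0n subr0.
rewrite sumr_const -[leLHS]mulr_natl ler_wpM2r ?(moment_even_ge0 _ 1)// ler_nat.
exact: card_perm_eq_tuples.
Qed.

Context (q : nat) (B al be : R).
Hypothesis al0 : 0 <= al.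
Hypothesis be0 : 0 <= be.
Hypothesis q0 : (0 < q)%N.
Hypothesis moment_le : forall i j, (0 < j)%N -> (j <= (2 * q).+1)%N ->
  moment i (2 * j) <= B.

(** Sorted forms are collected in a set, so that each independent entry touching [a] carries its
    density factor once, however many indices name it. *)
Definition touching_indices : {set p.+2.-tuple 'I_N} :=
  [set sort_index (cons_index bt) | bt in [set: 'I_N * p.-tuple 'I_N]]%SET.

(* For [be = 0] this is the density of the argument, and for
   [(2 al, al ^+ 2)] in place of [(al, be)] it is the square of that density. *)
Definition tilt_poly (k : p.+2.-tuple 'I_N) (x : R) : R :=
  1 + (k \in touching_indices)%:R * (al * x ^+ (2 * q) + be * x ^+ (2 * (2 * q))).

Local Notation y := tilt_poly.

Lemma tilt_poly_ge1 k x : 1 <= y k x.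
Proof.
rewrite lerDl mulr_ge0// addr_ge0// mulr_ge0// exprM.
  by rewrite exprn_ge0// sqr_ge0.
by rewrite exprn_ge0// sqr_ge0.
Qed.

Lemma tilt_poly_ge0 k x : 0 <= y k x.
Proof. exact: le_trans ler01 (tilt_poly_ge1 k x). Qed.

Lemma measurable_tilt_poly k : measurable_fun setT (y k).
Proof.
apply: measurable_funD => //; apply: measurable_funM => //.
by apply: measurable_funD; apply: measurable_funM => //; exact: measurable_funX.
Qed.

Lemma tilt_poly_moment k n :
  P.-integrable setT (fun w => (T k w ^+ n * y k (T k w))%:E) /\
  \int[P]_w (T k w ^+ n * y k (T k w)) = moment k n +
    (k \in touching_indices)%:R *
      (al * moment k (2 * q + n) + be * moment k (2 * (2 * q) + n)).
Proof.
set s := (_)%:R.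
have E w : T k w ^+ n * y k (T k w) = T k w ^+ n +
    s * (al * T k w ^+ (2 * q + n) + be * T k w ^+ (2 * (2 * q) + n)).
  by rewrite /y -/s !exprD; ring.
have i1 m := T_integrable k m.
have i2 c m : P.-integrable setT (EFin \o (fun w => c * T k w ^+ m)).
  by apply: integrableZR; exact: i1.
have i3 : P.-integrable setT (EFin \o (fun w =>
    al * T k w ^+ (2 * q + n) + be * T k w ^+ (2 * (2 * q) + n))).
  by apply: integrableDR; exact: i2.
have i4 := integrableZR s i3.
split; first by under eq_fun do rewrite E; exact: integrableDR (i1 n) i4.
under eq_Rintegral => w _ do rewrite E.
rewrite RintegralD//; last exact: i1.
rewrite RintegralZl// RintegralD; [|by []|exact: i2|exact: i2].
by rewrite RintegralZl ?RintegralZl//; exact: i1.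
Qed.

Lemma tilt_poly_mass k : \int[P]_w y k (T k w) = 1 +
  (k \in touching_indices)%:R * (al * moment k (2 * q) + be * moment k (2 * (2 * q))).
Proof.
have := (tilt_poly_moment k 0).2; rewrite moment0 !addn0 => <-.
by apply: eq_Rintegral => w _; rewrite expr0 mul1r.
Qed.

Lemma tilt_poly_mass_ge1 k : 1 <= \int[P]_w y k (T k w).
Proof.
by rewrite tilt_poly_mass lerDl mulr_ge0// addr_ge0// mulr_ge0// moment_even_ge0.
Qed.

Lemma tilt_poly_mass_le k :
  \int[P]_w y k (T k w) <= 1 + (k \in touching_indices)%:R * ((al + be) * B).
Proof.
rewrite tilt_poly_mass lerD2l ler_wpM2l// mulrDl lerD// ler_wpM2l// moment_le//.
- exact: leqW (leq_pmull _ _).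
- by rewrite muln_gt0.
Qed.

Lemma tilt_poly_mass_gt0 k : 0 < \int[P]_w y k (T k w).
Proof. exact: lt_le_trans ltr01 (tilt_poly_mass_ge1 k). Qed.

Let B0 : 0 <= B.
Proof.
pose k : p.+2.-tuple 'I_N := [tuple a | _ < p.+2].
by apply: le_trans (moment_even_ge0 k 1) _; exact: moment_le.
Qed.

(** Centering kills the constant term of the density. What remains are higher odd moments, each at
    most a sum of two even ones, whence the 2. *)
Lemma normr_tilt_moment1_le k : `|tilt_moment T y 1 k| <= 2 * ((al + be) * B).
Proof.
rewrite /tilt_moment normrM normfV (ger0_norm (ltW (tilt_poly_mass_gt0 k))).
rewrite ler_pdivrMr ?tilt_poly_mass_gt0//.
have Bpos : 0 <= 2 * ((al + be) * B) by rewrite !mulr_ge0// addr_ge0.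
apply: le_trans (ler_peMr Bpos (tilt_poly_mass_ge1 k)).
rewrite (tilt_poly_moment k 1).2 moment1 add0r normrM ger0_norm//.
apply: (@le_trans _ _ `|al * moment k (2 * q + 1) + be * moment k (2 * (2 * q) + 1)|).
  by rewrite ler_piMl// lern1 leq_b1.
apply: le_trans (ler_normD _ _) _; rewrite !normrM (ger0_norm al0) (ger0_norm be0).
have bound j : (0 < j)%N -> (j <= 2 * q)%N -> `|moment k (2 * j + 1)| <= 2 * B.
  move=> j0 jq; apply: le_trans (normr_moment_odd _ _) _.
  rewrite mulr_natl mulr2n lerD ?moment_le ?leqW//.
  by rewrite (_ : 2 * j + 2 = 2 * j.+1)%N ?moment_le// mulnS addnC.
have b1 := bound q q0 (leq_pmull q (isT : 0 < 2)%N).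
have b2 : `|moment k (2 * (2 * q) + 1)| <= 2 * B by apply: bound; rewrite ?muln_gt0.
have := ler_wpM2l al0 b1; have := ler_wpM2l be0 b2; lra.
Qed.

Lemma tilt_moment2_le k : tilt_moment T y 2 k <= (1 + (al + be)) * B.
Proof.
rewrite /tilt_moment ler_pdivrMr ?tilt_poly_mass_gt0//.
have Bpos : 0 <= (1 + (al + be)) * B by rewrite mulr_ge0// !addr_ge0.
apply: le_trans (ler_peMr Bpos (tilt_poly_mass_ge1 k)).
rewrite (tilt_poly_moment k 2).2 mulrDl mul1r.
apply: lerD; first by apply: (moment_le k (j := 1)).
have e1 : moment k (2 * q + 2) <= B.
  by rewrite (_ : 2 * q + 2 = 2 * q.+1)%N ?moment_le ?ltnS ?leq_pmull// mulnS addnC.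
(* The order 4q + 2 is the highest one needed, from T^2 against the squared density; it sets the
   range of [moment_le]. *)
have e2 : moment k (2 * (2 * q) + 2) <= B.
  by rewrite (_ : 2 * (2 * q) + 2 = 2 * (2 * q).+1)%N ?moment_le// mulnS addnC.
have h : al * moment k (2 * q + 2) + be * moment k (2 * (2 * q) + 2) <= (al + be) * B.
  by rewrite mulrDl lerD// ler_wpM2l.
case: (k \in touching_indices); first by rewrite mul1r.
by rewrite mul0r mulr_ge0 ?addr_ge0.
Qed.

(** Here M_(2r) enters, with r = q + 1: T^2 meets the term of degree 2q of the density. *)
Lemma tilt_moment2_ge k : k \in touching_indices ->
  al * moment k (2 * q + 2) / (1 + (al + be) * B) <= tilt_moment T y 2 k.
Proof.
move=> kS; rewrite /tilt_moment.
have := tilt_poly_mass_le k; rewrite kS mul1r => mass_le.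
have m2 : 0 <= moment k (2 * q + 2).
  by rewrite (_ : 2 * q + 2 = 2 * q.+1)%N ?moment_even_ge0// mulnS addnC.
apply: (@le_trans _ _ (al * moment k (2 * q + 2) / \int[P]_w y k (T k w))).
  rewrite ler_wpM2l ?mulr_ge0// lef_pV2 ?posrE ?tilt_poly_mass_gt0//.
  exact: lt_le_trans (tilt_poly_mass_gt0 k) mass_le.
rewrite ler_wpM2r ?invr_ge0 ?(ltW (tilt_poly_mass_gt0 k))//.
rewrite (tilt_poly_moment k 2).2 kS mul1r addrCA lerDl addr_ge0//.
  exact: (moment_even_ge0 k 1).
rewrite mulr_ge0// (_ : 2 * (2 * q) + 2 = 2 * (2 * q).+1)%N ?moment_even_ge0//.
by rewrite mulnS addnC.
Qed.

Lemma tilt_mass_ge1 : 1 <= tilt_mass T y.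
Proof.
rewrite /tilt_mass; elim/big_ind: _ => // [u v u1 v1|k _].
  by rewrite mulr_ege1.
exact: tilt_poly_mass_ge1.
Qed.

Lemma card_touching_indices : (#|touching_indices| <= N ^ p.+1)%N.
Proof.
apply: leq_trans (leq_imset_card _ _) _.
by rewrite cardsT card_prod card_tuple card_ord -expnS.
Qed.

(** By 1 + x <= exp x in each factor. Since [B] will be a constant over N^(p+1), the exponent stays
    bounded in N. *)
Lemma tilt_mass_le : tilt_mass T y <= expR ((al + be) * B * (N ^ p.+1)%:R).
Proof.
have c0 : 0 <= (al + be) * B by rewrite mulr_ge0// addr_ge0.
apply: (@le_trans _ _ (\prod_(k in sorted_indices p.+2 N)
    expR ((k \in touching_indices)%:R * ((al + be) * B)))).
  apply: ler_prod => k _; rewrite ltW ?tilt_poly_mass_gt0//=.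
  by apply: le_trans (tilt_poly_mass_le k) _; exact: expR_ge1Dx.
rewrite -expR_sum ler_expR -mulr_suml mulrC ler_wpM2l//.
rewrite -natr_sum ler_nat; apply: leq_trans card_touching_indices.
rewrite -sum1_card big_mkcond [leqRHS]big_mkcond /=.
by apply: leq_sum => k _; do 2 case: (_ \in _).
Qed.

Let kappa := 2 * ((al + be) * B).

Let kappa_ge0 : 0 <= kappa. Proof. by rewrite !mulr_ge0// addr_ge0. Qed.

Lemma expectation_tilt_poly : P.-integrable setT (EFin \o tilt T y) /\
  \int[P]_w tilt T y w = tilt_mass T y.
Proof.
apply: (expectation_tilt T_indep measurable_tilt_poly).
by move=> k n _; exact: (tilt_poly_moment k n).1.
Qed.

Lemma expectation_row_sqr_tilt :
  P.-integrable setT (EFin \o (fun w => row_sqr w * tilt T y w)) /\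
  \int[P]_w (row_sqr w * tilt T y w) = tilt_mass T y * \sum_b
    (\sum_(t : p.-tuple 'I_N) \sum_(u : p.-tuple 'I_N | perm_eq t u)
       (tilt_moment T y 2 (sort_index (cons_index (b, t))) -
        tilt_moment T y 1 (sort_index (cons_index (b, t))) ^+ 2) +
     (\sum_t tilt_moment T y 1 (sort_index (cons_index (b, t)))) ^+ 2).
Proof.
have H b := expectation_sum_sqr_tilt T_sym T_indep (y := y)
  measurable_tilt_poly (fun k n _ => (tilt_poly_moment k n).1)
  tilt_poly_mass_gt0 (fun t => cons_index (b, t)).
have E w : row_sqr w * tilt T y w =
    \sum_b (\sum_t T (cons_index (b, t)) w) ^+ 2 * tilt T y w.
  by rewrite /row_sqr mulr_suml.
split.
  under [X in integrable _ _ (_ \o X)]eq_fun do rewrite E.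
  by apply: integrable_sumR => b _; exact: (H b).1.
under eq_Rintegral => w _ do rewrite E.
rewrite Rintegral_sum; last by move=> b _; exact: (H b).1.
rewrite mulr_sumr; apply: eq_bigr => b _; rewrite (H b).2; congr (_ * (_ + _)).
by apply: eq_bigr => t _; apply: eq_bigl => u; exact: perm_cons_index.
Qed.

Lemma expectation_row_sqr_tilt_le :
  \int[P]_w (row_sqr w * tilt T y w) <= tilt_mass T y *
    (N%:R * ((N ^ p)%:R * (p`!%:R * ((1 + (al + be)) * B)) + ((N ^ p)%:R * kappa) ^+ 2)).
Proof.
rewrite expectation_row_sqr_tilt.2 ler_wpM2l ?(le_trans ler01 tilt_mass_ge1)//.
rewrite mulr_natl -[X in _ *+ X]card_ord -sumr_const; apply: ler_sum => b _.
have cardt : #|{: p.-tuple 'I_N}| = (N ^ p)%N by rewrite card_tuple card_ord.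
apply: lerD.
  rewrite mulr_natl -cardt -sumr_const; apply: ler_sum => t _.
  apply: (@le_trans _ _ (\sum_(u : p.-tuple 'I_N | perm_eq t u) (1 + (al + be)) * B)).
    apply: ler_sum => u _; apply: le_trans (tilt_moment2_le (sort_index (cons_index (b, t)))).
    by rewrite lerBlDr lerDl sqr_ge0.
  rewrite sumr_const -[leLHS]mulr_natl ler_wpM2r ?ler_nat ?card_perm_eq_tuples//.
  by rewrite mulr_ge0// !addr_ge0.
rewrite -real_normK ?num_real// ler_pXn2r ?nnegrE ?(mulr_ge0 _ kappa_ge0)//.
apply: le_trans (ler_norm_sum _ _ _) _.
rewrite mulr_natl -cardt -sumr_const; apply: ler_sum => t _.
exact: normr_tilt_moment1_le.
Qed.

(** Only the variances with u = t and with distinct a, b, t are kept, the moment bound [G] being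
    available for distinct indices alone. *)
Lemma expectation_row_sqr_tilt_ge (G : R) :
  (forall i : p.+2.-tuple 'I_N, uniq i -> G <= moment i (2 * q + 2)) ->
  tilt_mass T y *
    ((N.-1 ^_ p.+1)%:R * (al * G / (1 + (al + be) * B) - kappa ^+ 2)) <=
  \int[P]_w (row_sqr w * tilt T y w).
Proof.
move=> GT; rewrite expectation_row_sqr_tilt.2 ler_wpM2l ?(le_trans ler01 tilt_mass_ge1)//.
pose D bt := tilt_moment T y 2 (sort_index (cons_index bt)) -
  tilt_moment T y 1 (sort_index (cons_index bt)) ^+ 2.
have D0 bt : 0 <= D bt.
  apply: tilt_moment_ge0 => //.
  - exact: tilt_poly_ge0.
  - by move=> k n _; exact: (tilt_poly_moment k n).1.
  - exact: tilt_poly_mass_gt0.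
apply: (@le_trans _ _ (\sum_b \sum_t D (b, t))); last first.
  apply: ler_sum => b _; rewrite -[leLHS]addr0 lerD ?sqr_ge0//.
  apply: ler_sum => t _; rewrite (bigD1 t)//= -/(D (b, t)) lerDl.
  by apply: sumr_ge0 => u _; exact: D0.
have := card_uniq_cons2 p a; rewrite card_ord => <-; rewrite pair_bigA /=.
rewrite mulr_natl -sumr_const big_mkcond /=; apply: ler_sum => bt _.
rewrite -surjective_pairing.
have [ubt|_] := boolP (bt \in _); last exact: D0.
have {}ubt : uniq (cons_index bt) by move: ubt; rewrite inE.
apply: lerB.
  apply: le_trans (tilt_moment2_ge _); last by apply: imset_f.
  rewrite moment_sort_index ler_wpM2r ?invr_ge0 ?addr_ge0 ?mulr_ge0 ?addr_ge0//.
  by rewrite ler_wpM2l// GT.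
rewrite -real_normK ?num_real// ler_pXn2r ?nnegrE//.
exact: normr_tilt_moment1_le.
Qed.

End PolynomialTilt.

(** * Uniform gain from truncating one row *)

Section TruncatedRow.
Context (R : realType) (d : measure_display) (Omega : measurableType d).
Context (P : probability Omega R) (p N : nat).
Context (T : p.+2.-tuple 'I_N -> {RV P >-> R}).
Hypothesis T_sym : forall i j : p.+2.-tuple 'I_N, perm_eq i j -> T i =1 T j.
Hypothesis T_indep : mutually_independent (@nondecreasing_index N p.+2) T.
Hypothesis T_integrable : forall i k,
  P.-integrable setT (fun w => (T i w ^+ k)%:E).
Hypothesis T_centered : forall i, \int[P]_w (T i w) = 0.
Context (a : 'I_N) (q : nat) (K G m2 c g : R).
Hypothesis q0 : (0 < q)%N.
Hypothesis K0 : 0 < K.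
Hypothesis G0 : 0 < G.
Hypothesis m20 : 0 <= m2.
Hypothesis c0 : 0 <= c.
Hypothesis g0 : 0 < g.

Let L : R := (N ^ p.+1)%:R.
(* Chosen such that the lower bound for [g * E(S Y) / E Y] is [c + 1]. *)
Let theta := 8 * (c + 1) / (g * G).
Let lam := 2 * theta + theta ^+ 2.

(** The inverse of a bound V on g E(S Y^2), free of N; [lam] is the sum of the coefficients of Y^2.
    It minimizes -2t + V t^2, with minimum -1/V, which is the gain. *)
Definition truncation_gain : R :=
  (g * expR (lam * K) * (p`!%:R * ((1 + lam) * K) + (2 * (lam * K)) ^+ 2))^-1.

Hypothesis moment_le : forall i j, (0 < j)%N -> (j <= (2 * q).+1)%N ->
  L * moment T i (2 * j) <= K.
Hypothesis moment_ge : forall i : p.+2.-tuple 'I_N, uniq i ->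
  G <= L * moment T i (2 * q + 2).
Hypothesis moment2_le : forall i : p.+2.-tuple 'I_N, uniq i ->
  L * moment T i 2 <= m2.
Hypothesis N_large1 : ((2 * p.+2 ^ 2) <= N)%N.
Hypothesis N_large2 : theta * K <= N%:R.
Hypothesis N_large3 : 16 * theta * K ^+ 2 <= G * N%:R.

Let N0 : (0 < N)%N. Proof. exact: leq_trans N_large1. Qed.
Let NR0 : 0 < N%:R :> R. Proof. by rewrite ltr0n. Qed.
Let L0 : 0 < L. Proof. by rewrite /L ltr0n expn_gt0 N0. Qed.
Let NL : N%:R <= L.
Proof. by rewrite /L ler_nat expnS leq_pmulr// expn_gt0 N0. Qed.
Let LE : L = N%:R * (N ^ p)%:R. Proof. by rewrite /L expnS natrM. Qed.

Let theta0 : 0 < theta.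
Proof.
have c1 : 0 < c + 1 by rewrite ltr_wpDl.
by rewrite /theta divr_gt0// mulr_gt0.
Qed.
Let lam0 : 0 < lam. Proof. by apply: addr_gt0; [exact: mulr_gt0|exact: exprn_gt0]. Qed.

Let B := K / L.
Let B0 : 0 <= B. Proof. by apply: divr_ge0; exact: ltW. Qed.
Let moment_le_B i j : (0 < j)%N -> (j <= (2 * q).+1)%N -> moment T i (2 * j) <= B.
Proof. by move=> j0 jq; rewrite /B ler_pdivlMr// mulrC moment_le. Qed.

Lemma truncation_gain_gt0 : 0 < truncation_gain.
Proof.
rewrite invr_gt0 mulr_gt0 ?mulr_gt0 ?expR_gt0// ltr_wpDr ?sqr_ge0//.
by rewrite !mulr_gt0 ?ltr0n ?fact_gt0// addr_gt0.
Qed.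

Lemma uniq_index_count :
  [/\ L <= (N.-1 ^_ p.+1)%:R + (p.+2 ^ 2 * N ^ p)%:R,
      L / 2 <= (N.-1 ^_ p.+1)%:R & (N.-1 ^_ p.+1)%:R <= L].
Proof.
have h : (N ^ p.+1 <= N.-1 ^_ p.+1 + p.+2 ^ 2 * N ^ p)%N.
  have := leq_expn_ffact N p.+2; rewrite ffactnS /= (expnS N p.+1).
  rewrite (_ : p.+2 ^ 2 * N ^ p.+1 = N * (p.+2 ^ 2 * N ^ p))%N; last first.
    by rewrite (expnS N p) mulnCA.
  by rewrite -mulnDr leq_pmul2l.
split.
- by rewrite /L -natrD ler_nat.
- have h2 : (2 * (p.+2 ^ 2 * N ^ p) <= N ^ p.+1)%N.
    by rewrite mulnA (expnS N p) leq_mul2r N_large1 orbT.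
  rewrite ler_pdivrMr// -natrM ler_nat.
  move: h h2; move: (N ^ p.+1)%N (p.+2 ^ 2 * N ^ p)%N (N.-1 ^_ p.+1)%N => x y z.
  by clear; lia.
- by rewrite ler_nat (leq_trans (ffact_leq_expn _ _))// leq_exp2r// leq_pred.
Qed.

Let Y := tilt T (tilt_poly a q theta 0).
Let Y2 := tilt T (tilt_poly a q (2 * theta) (theta ^+ 2)).
Let S := row_sqr T a.

Lemma sqr_tilt w : Y w ^+ 2 = Y2 w.
Proof.
rewrite /Y /Y2 /tilt -prodrXl; apply: eq_bigr => k _.
rewrite /tilt_poly (mulnC 2 (2 * q)) (exprM _ (2 * q)) mul0r addr0.
by case: (k \in _); rewrite ?mul1r ?mul0r ?addr0 ?expr1n//; ring.
Qed.

(** Distinct indices satisfy the sharp bound [m2]. The others satisfy only the crude bound [K], but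
    number O(N^p) among N^(p+1), whence the error term in 1/N. *)
Lemma mean_row_sqr_le : P.-integrable setT (EFin \o S) /\
  \int[P]_w S w <= p`!%:R * (m2 + (p.+2 ^ 2)%:R * K / N%:R).
Proof.
have [iS ES] := expectation_row_sqr_le T_sym T_indep T_integrable T_centered a.
split => //; apply: (le_trans ES); rewrite ler_wpM2l//.
pose u (bt : 'I_N * p.-tuple 'I_N) := uniq (cons_index a bt).
rewrite -(ler_pM2l L0) mulr_sumr (bigID u) /=.
have [cnt1 _ cnt2] := uniq_index_count.
have cardu : #|u| = (N.-1 ^_ p.+1)%N.
  by have := card_uniq_cons2 p a; rewrite card_ord => <-.
have cardn : #|[predC u]| = (N ^ p.+1 - N.-1 ^_ p.+1)%N.
  rewrite -cardu -[(N ^ p.+1)%N](_ : #|{: 'I_N * p.-tuple 'I_N}| = _).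
    by rewrite -(cardC u) addKn.
  by rewrite card_prod card_tuple card_ord -expnS.
have h1 : \sum_(bt | u bt) L * moment T (cons_index a bt) 2 <= L * m2.
  apply: (@le_trans _ _ (\sum_(bt | u bt) m2)).
    by apply: ler_sum => bt ubt; exact: moment2_le.
  by rewrite sumr_const cardu -[leLHS]mulr_natl ler_wpM2r.
have h2 : \sum_(bt | ~~ u bt) L * moment T (cons_index a bt) 2 <=
    (p.+2 ^ 2 * N ^ p)%:R * K.
  apply: (@le_trans _ _ (\sum_(bt | ~~ u bt) K)).
    by apply: ler_sum => bt _; exact: (moment_le _ (j := 1)).
  rewrite sumr_const cardn -[leLHS]mulr_natl ler_wpM2r ?(ltW K0)//.
  have cle : (N.-1 ^_ p.+1 <= N ^ p.+1)%N by rewrite -(ler_nat R).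
  by rewrite natrB// lerBlDl.
apply: (le_trans (lerD h1 h2)); rewrite mulrDr lerD2l LE natrM.
rewrite le_eqVlt; apply/orP; left; apply/eqP; field.
by rewrite gt_eqF.
Qed.

Lemma tilted_row_sqr_ge :
  [/\ P.-integrable setT (EFin \o Y),
      P.-integrable setT (EFin \o (fun w => S w * Y w)) &
      1 <= g * (\int[P]_w (S w * Y w)) - c * \int[P]_w Y w].
Proof.
have [iY EY] := expectation_tilt_poly T_indep T_integrable a q theta 0.
have [iSY _] := expectation_row_sqr_tilt T_sym T_indep T_integrable a q (ltW theta0) (lexx (0 : R)).
have GB (i : p.+2.-tuple 'I_N) : uniq i -> G / L <= moment T i (2 * q + 2).
  by move=> ui; rewrite ler_pdivrMr// mulrC moment_ge.
have ESY := expectation_row_sqr_tilt_ge T_sym T_indep T_integrable T_centered a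
  (ltW theta0) (lexx (0 : R)) q0 moment_le_B GB.
have Z1 := tilt_mass_ge1 T_integrable a q (ltW theta0) (lexx (0 : R)).
split => //.
rewrite EY; move: Z1 ESY; rewrite -/Y -/S addr0.
set Z := tilt_mass _ _; set E := \int[P]_w _ => Z1 ESY.
have [_ cnt _] := uniq_index_count.
set n := (_ ^_ _)%:R in ESY cnt.
have thB : theta * B <= 1.
  by rewrite /B mulrA ler_pdivrMr// mul1r; exact: le_trans N_large2 NL.
have thB0 : 0 <= theta * B by rewrite mulr_ge0// ltW.
(* The mass of one factor is at most 2 by [N_large2], and the squared mean takes at most half of
   what is left by [N_large3]. With the half of the indices that are distinct, these three halvings
   make up the 8 in [theta]. *)
have bracket : theta * G / (4 * L) <=
    theta * (G / L) / (1 + theta * B) - (2 * (theta * B)) ^+ 2.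
  have e1 : theta * G / (2 * L) <= theta * (G / L) / (1 + theta * B).
    rewrite (_ : theta * G / (2 * L) = theta * (G / L) / 2); last first.
      by field; rewrite gt_eqF.
    rewrite ler_wpM2l ?(mulr_ge0 (ltW theta0) (divr_ge0 (ltW G0) (ltW L0)))//.
    by rewrite lef_pV2 ?posrE//; lra.
  have e2 : (2 * (theta * B)) ^+ 2 <= theta * G / (4 * L).
    rewrite ler_pdivlMr ?mulr_gt0//.
    rewrite (_ : _ * (4 * L) = theta * (16 * theta * K ^+ 2 / L)); last first.
      by rewrite /B; field; rewrite gt_eqF.
    rewrite ler_wpM2l ?(ltW theta0)// ler_pdivrMr//.
    by apply: le_trans N_large3 _; rewrite ler_wpM2l// ltW.
  have e3 : theta * G / (2 * L) = theta * G / (4 * L) + theta * G / (4 * L).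
    by field; rewrite gt_eqF.
  by rewrite lerBrDr; apply: le_trans e1; rewrite e3 lerD2l.
have nbr : theta * G / 8 <= n * (theta * G / (4 * L)).
  have -> : theta * G / 8 = L / 2 * (theta * G / (4 * L)).
    by field; rewrite gt_eqF.
  by rewrite ler_wpM2r// divr_ge0// ltW// mulr_gt0.
have thE : theta * G / 8 = (c + 1) / g.
  by rewrite /theta; field; rewrite !gt_eqF.
have n0 : 0 <= n by rewrite /n.
have gE : Z * (c + 1) <= g * E.
  have : Z * ((c + 1) / g) <= E.
    apply: le_trans ESY; rewrite ler_wpM2l ?(le_trans ler01 Z1)// -thE.
    by apply: (le_trans nbr); rewrite ler_wpM2l.
  by rewrite mulrA ler_pdivrMr// [E * g]mulrC.
by move: gE; rewrite mulrDr mulr1 [Z * c]mulrC; lra.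
Qed.

Lemma tilted_sqr_row_sqr_le :
  P.-integrable setT (EFin \o (fun w => S w * Y2 w)) /\
  g * (\int[P]_w (S w * Y2 w)) <= truncation_gain^-1.
Proof.
have t20 : 0 <= 2 * theta by rewrite mulr_ge0// ltW.
have tt0 : 0 <= theta ^+ 2 by rewrite sqr_ge0.
have [iSY _] := expectation_row_sqr_tilt T_sym T_indep T_integrable a q t20 tt0.
have ESY := expectation_row_sqr_tilt_le T_sym T_indep T_integrable T_centered a
  t20 tt0 q0 moment_le_B.
have Zle := tilt_mass_le T_integrable a t20 tt0 q0 moment_le_B.
split => //; rewrite invrK -mulrA ler_wpM2l ?(ltW g0)//.
have e1 : (2 * theta + theta ^+ 2) * B * (N ^ p.+1)%:R = lam * K.
  by rewrite -/lam -/L /B; field; rewrite gt_eqF.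
rewrite e1 in Zle; apply: (le_trans ESY).
have Np : N%:R * (N ^ p)%:R * B = K by rewrite -LE /B mulrC divfK ?gt_eqF.
rewrite -/lam; apply: ler_pM => //.
- exact: le_trans ler01 (tilt_mass_ge1 T_integrable a q t20 tt0).
- have lam1 : 0 <= 1 + lam by apply: addr_ge0 => //; exact: ltW.
  apply: mulr_ge0 => //; apply: addr_ge0; last exact: sqr_ge0.
  by do 3 (apply: mulr_ge0 => //).
- rewrite mulrDr; apply: lerD.
    rewrite (_ : _ * _ = p`!%:R * ((1 + lam) * (N%:R * (N ^ p)%:R * B))); last by ring.
    by rewrite Np.
  rewrite (_ : _ * _ = (N%:R * (N ^ p)%:R * B * (2 * lam)) ^+ 2 / N%:R); last first.
    by field; rewrite gt_eqF.
  rewrite Np (_ : K * (2 * lam) = 2 * (lam * K)); last by ring.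
  by rewrite ler_pdivrMr// ler_peMr ?sqr_ge0// ler1n.
Qed.

(* The inequality [min(S, c) <= S - 2t Y (S - c) + t^2 Y^2 S], valid for all
   [S, Y, c >= 0], is integrated with [t] equal to the gain. *)
Lemma truncated_row_sqr_le :
  \int[P]_w Num.min (g * S w) c <=
  g * p`!%:R * (m2 + (p.+2 ^ 2)%:R * K / N%:R) - truncation_gain.
Proof.
have [iS ES] := mean_row_sqr_le.
have [iY iSY ESY] := tilted_row_sqr_ge.
have [iSY2 ESY2] := tilted_sqr_row_sqr_le.
set t := truncation_gain in ESY2 *.
have t0 : 0 < t := truncation_gain_gt0.
pose U w := g * S w + (- (2 * t * g) * (S w * Y w) +
  (2 * t * c * Y w + t ^+ 2 * g * (S w * Y2 w))).
have iU1 := integrableZR g iS.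
have iU2 := integrableZR (- (2 * t * g)) iSY.
have iU3 := integrableZR (2 * t * c) iY.
have iU4 := integrableZR (t ^+ 2 * g) iSY2.
have iU34 := integrableDR iU3 iU4.
have iU234 := integrableDR iU2 iU34.
have iU : P.-integrable setT (EFin \o U) := integrableDR iU1 iU234.
have S0 w : 0 <= S w by exact: row_sqr_ge0.
have Y0 w : 0 <= Y w.
  by apply: prodr_ge0 => k _; apply: tilt_poly_ge0; rewrite // ltW.
have minU w : Num.min (g * S w) c <= U w.
  rewrite /U -sqr_tilt; have s0 := S0 w; have y0 := Y0 w.
  set s := S w in s0 *; set yy := Y w in y0 *.
  have gs0 : 0 <= g * s by rewrite mulr_ge0// ltW.
  have [gsc|cgs] := leP (g * s) c.
    rewrite (_ : _ + _ = g * s + (2 * t * yy * (c - g * s) + (t * yy) ^+ 2 * (g * s))).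
      by rewrite lerDl addr_ge0//; apply: mulr_ge0; rewrite ?subr_ge0 ?sqr_ge0// mulr_ge0// mulr_ge0// ltW.
    by ring.
  rewrite -subr_ge0.
  rewrite (_ : _ - c = (g * s - c) * (1 - t * yy) ^+ 2 + c * (t * yy) ^+ 2); last by ring.
  by rewrite addr_ge0// mulr_ge0 ?sqr_ge0 ?subr_ge0// ltW.
have imin : P.-integrable setT (EFin \o (fun w => Num.min (g * S w) c)).
  apply: (le_integrable _ _ _ iU1) => //.
    by apply/measurable_EFinP/measurable_minr => //; exact/measurable_EFinP/(measurable_int _ iU1).
  move=> w _ /=; rewrite lee_fin.
  have gS : 0 <= g * S w by rewrite mulr_ge0// ltW.
  rewrite (ger0_norm gS) ger0_norm ?le_min ?gS//.
  by rewrite ge_min lexx.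
apply: le_trans (le_Rintegral _ imin iU _) _ => //.
rewrite /U !RintegralD// !RintegralZl//.
have : g * \int[P]_w S w <= g * p`!%:R * (m2 + (p.+2 ^ 2)%:R * K / N%:R).
  by rewrite -mulrA ler_wpM2l// ltW.
have : 2 * t * 1 <= 2 * t * (g * (\int[P]_w (S w * Y w)) - c * \int[P]_w Y w).
  by rewrite ler_wpM2l// mulr_ge0// ltW.
have : t ^+ 2 * (g * \int[P]_w (S w * Y2 w)) <= t ^+ 2 * t^-1.
  by rewrite ler_wpM2l// sqr_ge0.
rewrite expr2 mulfK ?gt_eqF//.
lra.
Qed.


End TruncatedRow.

(** * Asymptotics *)

Section Limits.
Context (R : realType).

Lemma compactly_supported_trunc (nu : probability (measurableTypeR R) R)
    (m : nat -> R) :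
  has_moments nu m -> compactly_supported nu ->
  exists2 c : R, 0 <= c & \int[nu]_x Num.min (x ^+ 2) c = m 2.
Proof.
move=> /(_ 2)[im <-] [K [cK nuK]].
have mK : measurable (K : set (measurableTypeR R)).
  exact: closed_measurable (compact_closed (@Rhausdorff R) cK).
have [C [Creal CK]] := compact_bounded cK.
pose C1 := `|C| + 1.
have KC x : K x -> `|x| <= C1.
  by move=> Kx; apply: (CK C1) => //; rewrite /C1 ltr_pwDr// ler_norm.
exists (C1 ^+ 2); first exact: sqr_ge0.
have mf : measurable_fun [set: measurableTypeR R] (fun x : R => Num.min (x ^+ 2) (C1 ^+ 2)).
  by apply: measurable_minr => //; exact: measurable_funX.
rewrite /Rintegral; congr fine.
apply: ae_eq_integral => //.
- exact/measurable_EFinP.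
- exact: measurable_int im.
exists (~` K); split; [exact: measurableC|exact: nuK|].
move=> x /= /not_implyP[_ xK] Kx; apply: xK; congr EFin.
apply/min_idPl; rewrite -real_normK ?num_real//.
by rewrite ler_pXn2r ?nnegrE ?addr_ge0// KC.
Qed.

(** Off the deviation event [F] is at least I - e, and on it at least 0. Convergence in probability
    thus becomes a lower bound on expectations. *)
Lemma expectation_ge_of_probability (d : measure_display)
    (Omega : measurableType d) (P : probability Omega R) (F : Omega -> R)
    (I e : R) :
  P.-integrable setT (EFin \o F) -> (forall w, 0 <= F w) -> e <= I ->
  (I - e) * (1 - fine (P [set w | e < `|F w - I|])) <= \int[P]_w F w.
Proof.
move=> iF F0 eI; set A := [set w | _].
have mF : measurable_fun setT F by exact/measurable_EFinP/(measurable_int _ iF).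
have mA : measurable A.
  have -> : A = (fun w => `|F w - I|) @^-1` `]e, +oo[%classic.
    by apply/seteqP; split => w /=; rewrite in_itv/= andbT.
  rewrite -[X in measurable X]setTI.
  apply: (measurableT_comp (@normr_measurable R setT) (measurable_funB mF (measurable_cst I))) => //.
have mAC : measurable (~` A) by exact: measurableC.
have -> : 1 - fine (P A) = \int[P]_w \1_(~` A) w.
  transitivity (fine (P (~` A))); last by rewrite /Rintegral integral_indic ?setIT.
  rewrite probability_setC// -[P A]fineK ?fin_num_measure//.
have iI : P.-integrable setT (EFin \o \1_(~` A)) by exact: integrable_indic.
rewrite -RintegralZl//; apply: le_Rintegral => //.
  exact: (integrableZR _ iI).
move=> w _; rewrite indicE; have [|_] := boolP (w \in _); last by rewrite mulr0.
rewrite inE mulr1 => /negP; rewrite -leNgt ler_norml => /andP[+ _].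
by rewrite lerBrDl addrC.
Qed.

End Limits.

Section Asymptotics.
Context (R : realType) (p : nat) (d : nat -> measure_display).
Context (Omega : forall N, measurableType (d N)).
Context (P : forall N, probability (Omega N) R).
Context (T : forall N, p.+2.-tuple 'I_N -> {RV (P N) >-> R}) (M : nat -> R).
Hypothesis hw : heavy_wigner T M.

Lemma scaled_moment_bounded k : (2 <= k)%N ->
  exists C, \forall N \near \oo, forall i : p.+2.-tuple 'I_N,
    scaled_moment T i k <= C.
Proof.
move=> k2; have /eqO_exP[C C0 hC] := hw_bounded hw k2.
exists C; near=> N => i.
have : `|sup (range (fun i : p.+2.-tuple 'I_N => scaled_moment T i k))| <= C * `|1|.
  by near: N.
rewrite normr1 mulr1 => /(le_trans (ler_norm _)); apply: le_trans.
apply: ub_le_sup; last by exists i.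
(* [sup] dominates its set only in the presence of an upper bound; the indices being finitely many,
   this sum is one. *)
exists (\sum_(j : p.+2.-tuple 'I_N) `|scaled_moment T j k|) => _ [j _ <-].
by rewrite (bigD1 j)//= (le_trans (ler_norm _))// lerDl sumr_ge0.
Unshelve. all: by end_near. Qed.

Lemma scaled_moment_bounded_upto n : exists2 K : R, 0 < K &
  \forall N \near \oo, forall (i : p.+2.-tuple 'I_N) j, (0 < j)%N -> (j <= n)%N ->
    scaled_moment T i (2 * j) <= K.
Proof.
elim: n => [|n [K K0 IH]].
  by exists 1 => //; near=> N => i j; case: j.
have [|C hC] := @scaled_moment_bounded (2 * n.+1); first by rewrite leq_pmulr.
exists (Num.max K C); first by rewrite lt_max K0.
near=> N => i j j0; rewrite leq_eqVlt => /orP[/eqP ->|jn].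
  by rewrite le_max; apply/orP; right; move: i; near: N.
by rewrite le_max; apply/orP; left; move: i j j0 jn; near: N.
Unshelve. all: by end_near. Qed.

Lemma scaled_moment_sort_index N (i : p.+2.-tuple 'I_N) k :
  scaled_moment T (sort_index i) k = scaled_moment T i k.
Proof.
by congr (_ * _); apply: eq_Rintegral => w _; rewrite (T_sort_index (@hw_symmetric _ _ _ _ _ _ _ hw N)).
Qed.

Lemma increasing_sort_index N (i : p.+2.-tuple 'I_N) :
  uniq i -> increasing_index (sort_index i).
Proof.
move=> ui; rewrite /increasing_index ltn_sorted_uniq_leq.
rewrite (map_inj_uniq val_inj) (perm_uniq (perm_sort_index i)) ui.
exact: sort_index_nondecreasing.
Qed.

Lemma scaled_moment_near k (e : R) : (2 <= k)%N -> 0 < e ->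
  \forall N \near \oo, forall i : p.+2.-tuple 'I_N, uniq i ->
    `|scaled_moment T i k - M k| < e.
Proof.
move=> k2 e0; near=> N => i ui; rewrite -scaled_moment_sort_index.
have : increasing_index (sort_index i) by exact: increasing_sort_index.
move: (sort_index i); near: N; exact: (hw_limit hw).
Unshelve. all: by end_near. Qed.

Let s : R := (Num.sqrt (M 2 * p`!%:R))^-1.

Lemma contracted_mxE N (w : Omega N) (a b : 'I_N) :
  contracted_mx T M w a b = s * \sum_t T (cons_index a (b, t)) w :> R.
Proof.
rewrite mxE subSS subn1 /=; congr (_ * _).
exact: sum_take2.
Qed.

Lemma contracted_mx_sym N (w : Omega N) : (contracted_mx T M w)^T = contracted_mx T M w.
Proof.
apply/matrixP => a b; rewrite mxE !contracted_mxE; congr (_ * _).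
apply: eq_bigr => t _; apply: (hw_symmetric hw).
by apply/seq.permP => h /=; rewrite addnCA.
Qed.

Lemma contracted_mx_sqr_diag N (w : Omega N) a :
  (contracted_mx T M w ^+ 2) a a = s ^+ 2 * row_sqr (@T N) a w.
Proof.
rewrite expr2 -mulmxE mxE /row_sqr mulr_sumr; apply: eq_bigr => b _.
have -> : contracted_mx T M w b a = contracted_mx T M w a b.
  by rewrite -[in LHS](contracted_mx_sym w) [LHS]mxE.
by rewrite contracted_mxE -expr2 exprMn.
Qed.

Lemma measurable_contracted_mx N (a b : 'I_N) :
  measurable_fun setT (fun w : Omega N => contracted_mx T M w a b).
Proof.
under eq_fun do rewrite contracted_mxE.
by apply: measurable_funM => //; apply: measurable_sum => t; exact: measurable_funPT.
Qed.

Lemma tensor_centered N (i : p.+2.-tuple 'I_N) : \int[P N]_w T i w = 0.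
Proof.
by have := hw_centered hw i; rewrite expectation_def /Rintegral => ->.
Qed.

Lemma not_compactly_supported_of_moment2 (nu : probability (measurableTypeR R) R)
    (m : nat -> R) (r : nat) :
  0 < M 2 -> (1 < r)%N -> 0 < M (2 * r)%N ->
  cvg_weakly_in_probability P (fun N w => esd (contracted_mx T M w)) nu ->
  has_moments nu m -> 1 <= m 2 -> ~ compactly_supported nu.
Proof.
move=> M2 r1 Mr cvg_nu nu_m m2 nu_supp.
have [c c0 Ic] := compactly_supported_trunc nu_m nu_supp.
pose f (x : R) := Num.min (x ^+ 2) c.
have f_ge0 x : 0 <= f x by rewrite le_min sqr_ge0 c0.
have f_cts : continuous f.
  move=> x; apply: (@continuous_min R R (fun x => x ^+ 2) (cst c) x).
    exact: exprn_continuous.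
  exact: cst_continuous.
have mf : measurable_fun setT f by exact: continuous_measurable_fun.
have f_bnd x : `|f x| <= c by rewrite ger0_norm// ge_min lexx orbT.
pose q := r.-1.
have q0 : (0 < q)%N by rewrite /q -ltnS prednK// ltnW.
have rE : (2 * r = 2 * q + 2)%N by rewrite /q; case: r r1 {Mr q q0} => // r _; rewrite mulnS addnC.
have [K K0 hK] := scaled_moment_bounded_upto (2 * q).+1.
pose G := M (2 * r)%N / 2; have G0 : 0 < G by rewrite divr_gt0.
pose g := s ^+ 2.
have fact0 : 0 < p`!%:R :> R by rewrite ltr0n fact_gt0.
have gE : g = (M 2 * p`!%:R)^-1.
  by rewrite /g /s exprVn sqr_sqrtr// mulr_ge0// ltW.
have g0 : 0 < g by rewrite gE invr_gt0 mulr_gt0.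
have gM : g * p`!%:R * M 2 = 1 by rewrite gE; field; rewrite !gt_eqF.
pose delta := truncation_gain p K G c g.
have delta0 : 0 < delta by exact: truncation_gain_gt0.
(* The mean of [F] will lie below 1 - delta/2 = 1 - 4e, whereas convergence keeps it above (1 - e)^2
   >= 1 - 2e. *)
pose e := delta / 8; have e0 : 0 < e by rewrite divr_gt0.
pose theta := 8 * (c + 1) / (g * G).
pose bad N := [set w : Omega N | e < `|\int[esd (contracted_mx T M w)]_x f x - m 2|].
have bad_small : \forall N \near \oo, fine (P N (bad N)) < e.
  have := cvg_nu f f_cts (ex_intro _ c f_bnd) e e0; rewrite Ic.
  by move=> /fine_cvgP[_ /cvgr_lt]; apply.
have hG := @scaled_moment_near (2 * r) G (leq_trans r1 (leq_pmull _ (isT : 0 < 2)%N)) G0.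
(* Half of the tolerated excess of the mean; the other half absorbs repeated indices. Normalized by
   [gM], together they cost delta/2 out of the gain delta. *)
have e1 : 0 < delta * M 2 / 4 by rewrite divr_gt0// mulr_gt0.
have hM := @scaled_moment_near 2 _ isT e1.
suff : \forall N \near \oo, False by move=> /filter_ex[].
near=> N.
have N1 : (2 * p.+2 ^ 2 <= N)%N by near: N; exact: nbhs_infty_ge.
have N2 : theta * K <= N%:R by near: N; exact: nbhs_infty_ger.
have N3 : 16 * theta * K ^+ 2 <= G * N%:R.
  by rewrite -(ler_pdivrMl _ _ G0); near: N; exact: nbhs_infty_ger.
have N4 : 4 * (p.+2 ^ 2)%:R * K / (delta * M 2) <= N%:R.
  by near: N; exact: nbhs_infty_ger.
have N0 : (0 < N)%N by exact: leq_trans N1.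
have NR0 : 0 < N%:R :> R by rewrite ltr0n.
pose A w := contracted_mx T M (N := N) w.
have A_sym w : (A w)^T = A w by exact: contracted_mx_sym.
pose F w := \int[esd (A w)]_x f x.
have FE w : F w = N%:R^-1 * \sum_i f (tnth (eigenvalues (A w)) i).
  by rewrite /F Rintegral_esd.
have F0 w : 0 <= F w.
  by rewrite FE mulr_ge0 ?invr_ge0//; apply: sumr_ge0.
have mF : measurable_fun setT F.
  rewrite (_ : F = fun w => N%:R^-1 * \sum_i f (tnth (eigenvalues (A w)) i)).
    apply: measurable_funM => //; apply: measurable_sum_trunc_sqr_eigenvalues => //.
    by move=> a b; exact: measurable_contracted_mx.
  by apply/funext => w; rewrite FE.
pose H a w := Num.min (g * row_sqr (@T N) a w) c.
have int_row a := (expectation_row_sqr_le (@hw_symmetric _ _ _ _ _ _ _ hw N)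
  (@hw_independent _ _ _ _ _ _ _ hw N) (@hw_finite_moments _ _ _ _ _ _ _ hw N)
  (@tensor_centered N) a).1.
have iH a : (P N).-integrable setT (EFin \o H a).
  apply: (le_integrable _ _ _ (integrableZR g (int_row a))) => //.
    apply/measurable_EFinP/measurable_minr => //; apply: measurable_funM => //.
    exact/measurable_EFinP/(measurable_int _ (int_row a)).
  move=> w _ /=; rewrite lee_fin.
  have gS : 0 <= g * row_sqr (@T N) a w by rewrite mulr_ge0 ?row_sqr_ge0// ltW.
  rewrite (ger0_norm gS) ger0_norm ?le_min ?gS ?c0//.
  by rewrite /H ge_min lexx.
have FH w : F w <= N%:R^-1 * \sum_a H a w.
  rewrite FE ler_wpM2l ?invr_ge0//.
  apply: le_trans (sum_trunc_sqr_eigenvalues_le c (A_sym w)) _.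
  by apply: ler_sum => a _; rewrite contracted_mx_sqr_diag.
have iG : (P N).-integrable setT (EFin \o (fun w => N%:R^-1 * \sum_a H a w)).
  by apply: integrableZR; apply: integrable_sumR => a _; exact: iH.
have iF : (P N).-integrable setT (EFin \o F).
  apply: (le_integrable _ _ _ iG) => //; first exact/measurable_EFinP.
  by move=> w _ /=; rewrite lee_fin ger0_norm// (le_trans (FH w))// ler_norm.
have EH a : \int[P N]_w H a w <= 1 - delta / 2.
  have := @truncated_row_sqr_le R _ _ (P N) p N (@T N) (@hw_symmetric _ _ _ _ _ _ _ hw N)
    (@hw_independent _ _ _ _ _ _ _ hw N) (@hw_finite_moments _ _ _ _ _ _ _ hw N)
    (@tensor_centered N) a q K G (M 2 + delta * M 2 / 4) c g q0 K0 G0.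
  have m20 : 0 <= M 2 + delta * M 2 / 4 by rewrite addr_ge0// ltW.
  have hK' : forall (i : p.+2.-tuple 'I_N) j, (0 < j)%N -> (j <= (2 * q).+1)%N ->
      (N ^ p.+1)%:R * moment (@T N) i (2 * j) <= K by near: N.
  have hG' : forall i : p.+2.-tuple 'I_N, uniq i ->
      G <= (N ^ p.+1)%:R * moment (@T N) i (2 * q + 2).
    move=> i ui; rewrite -rE.
    have : `|scaled_moment T i (2 * r) - M (2 * r)%N| < G by move: i ui; near: N.
    by rewrite ltr_norml => /andP[+ _]; rewrite /scaled_moment /moment /= /G; lra.
  have hM' : forall i : p.+2.-tuple 'I_N, uniq i ->
      (N ^ p.+1)%:R * moment (@T N) i 2 <= M 2 + delta * M 2 / 4.
    move=> i ui.
    have : `|scaled_moment T i 2 - M 2| < delta * M 2 / 4 by move: i ui; near: N.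
    by rewrite ltr_norml => /andP[_]; rewrite /scaled_moment /moment /=; lra.
  move=> /(_ m20 c0 g0 hK' hG' hM' N1 N2 N3); rewrite -/delta => h.
  apply: (le_trans h).
  have e4 : (p.+2 ^ 2)%:R * K / N%:R <= delta * M 2 / 4.
    move: N4; rewrite ler_pdivrMr ?mulr_gt0// ler_pdivrMr// => N4.
    lra.
  have : g * p`!%:R * (M 2 + delta * M 2 / 4 + (p.+2 ^ 2)%:R * K / N%:R) <=
      g * p`!%:R * (M 2 + delta * M 2 / 4 + delta * M 2 / 4).
    by rewrite ler_wpM2l ?lerD2l// mulr_ge0// ltW.
  have -> : g * p`!%:R * (M 2 + delta * M 2 / 4 + delta * M 2 / 4) =
      (g * p`!%:R * M 2) * (1 + delta / 2) by field.
  rewrite gM; lra.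
have EF : \int[P N]_w F w <= 1 - delta / 2.
  apply: le_trans (le_Rintegral _ iF iG _) _ => //.
  rewrite RintegralZl//; last by apply: integrable_sumR => a _; exact: iH.
  rewrite Rintegral_sum//.
  rewrite ler_pdivrMl// mulr_natl -[X in _ *+ X]card_ord -sumr_const.
  by apply: ler_sum => a _; exact: EH.
have EF0 : 0 <= \int[P N]_w F w by apply: Rintegral_ge0.
(* The smallness of [e] comes for free from 0 <= E F <= 1 - delta/2, and gives e <= 1 <= m 2. *)
have delta2 : delta <= 2 by lra.
have deltaE : delta = 8 * e by rewrite /e; field.
have e14 : e <= 4^-1 by lra.
have em : e <= m 2 by lra.
have Fb := expectation_ge_of_probability iF F0 em.
have badN : fine (P N (bad N)) < e by near: N.
move: Fb; rewrite -/(bad N); set b := fine _ in badN * => Fb.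
have : (1 - e) * (1 - e) <= (m 2 - e) * (1 - b).
  by apply: ler_pM; rewrite ?subr_ge0 ?lerD2r ?lerD2l ?lerN2 ?(ltW badN)//; lra.
have : 1 - 2 * e <= (1 - e) * (1 - e).
  by rewrite (_ : (1 - e) * (1 - e) = 1 - 2 * e + e ^+ 2) ?lerDl ?sqr_ge0//; ring.
lra.
Unshelve. all: by end_near. Qed.

End Asymptotics.

Theorem lemma1p11 (R : realType) (p : nat) (d : nat -> measure_display)
    (Omega : forall N : nat, measurableType (d N))
    (P : forall N : nat, probability (Omega N) R)
    (T : forall N : nat, p.-tuple 'I_N -> {RV (P N) >-> R})
    (M : nat -> R) (nu : probability (measurableTypeR R) R) :
  (2 <= p)%N ->
  heavy_wigner T M ->
  0 < M 2%N ->
  cvg_weakly_in_probability P (fun N w => esd (contracted_mx T M w)) nu ->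
  has_moments nu
    (eta p (fun r => (p - 2)`!%:R `^ (r%:R / 2) * M r / M 2%N `^ (r%:R / 2))) ->
  (exists r : nat, (1 < r)%N /\ 0 < M (2 * r)%N) ->
  ~ compactly_supported nu.
Proof.
case: p T => [|[|q]] // T _ hw M2 cvg_nu nu_moments [r [r1 Mr]].
apply: (not_compactly_supported_of_moment2 hw M2 r1 Mr cvg_nu nu_moments).
(* At r = 2 both exponents are 1 and M_2 cancels, leaving the factorial. *)
apply: eta2_ge1 => //=; rewrite divff ?pnatr_eq0// !powRr1 ?ler0n ?(ltW M2)//.
by rewrite mulfK ?gt_eqF.
Qed.
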